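(* Let $f\colon M^n(c)\to\mathbb{S}^{2n+1}_\epsilon(c)$ be a horizontal isometric immersion of a Riemannian manifold of constant sectional curvature $c$ with index of relative nullity $\nu_f\equiv0$. Let $(u_1,\ldots,u_n)$ be local principal coordinates and $v_1,\ldots,v_n$ positive functions such that $ds^2=\sum_iv_i^2du_i^2$ and $\alpha(\partial_i,\partial_j)=\delta_{ij}\phi f_*\partial_i$, and let $(v,h)$, with $h_{ij}=h_{ji}=v_i^{-1}\partial_iv_j$, be the associated solution of $$\partial_jv_i=h_{ji}v_j\ (i\neq j),\qquad\Bigl(\sum_{\ell=1}^n\partial_\ell\Bigr)h_{ij}+cv_iv_j=0\ (i\neq j),\qquad\partial_\ell h_{ij}=h_{i\ell}h_{j\ell}\ (\ell\neq i\neq j\neq\ell).\tag{1}$$ Let $P$ be an endomorphism of a Euclidean vector space $V$ such that $\sigma(P)\cap(-\sigma(P))=\emptyset$ and let $(\varphi,\gamma_1,\ldots,\gamma_n)$ be a $V$-valued solution of the linear system of PDEs $$\partial_i\varphi=v_i\gamma_i,\qquad\partial_i\gamma_j=h_{ji}\gamma_i,\ 1\le i\neq j\le n,\qquad\partial_i\gamma_i+\sum_{j\neq i}h_{ji}\gamma_j+(P^t)^{-1}\gamma_i+cv_i\varphi=0,$$ on an open subset $W$ where $$\tilde v_i=v_i+\langle\gamma_i,(P+P^{-1})\Omega^{-1}\varphi\rangle$$ does not vanish for $1\le i\le n$, where $\Omega$ is assumed invertible on $W$ and $\Omega^t=Y$ is the unique solution of $P^tY+YP=((P^t)^2+I)\bigl(d\varphi(d\varphi)^t+c\,\varphi\varphi^t\bigr)P$.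 Then $\tilde f\colon W\to\mathbb{S}^{2n+1}_\epsilon(c)$ given by $$\tilde F=\iota\circ\tilde f=F-\sum_{j=1}^n\bigl(\langle\Omega^{-1}\varphi,\gamma_j\rangle+\langle P\Omega^{-1}\varphi,\gamma_j\rangle\,i\bigr)F_*X_j-\bigl(\langle\Omega^{-1}\varphi,\varphi\rangle+\langle P\Omega^{-1}\varphi,\varphi\rangle\,i\bigr)cF,$$ where $X_j=v_j^{-1}\partial_j$, $\iota\colon\mathbb{S}^{2n+1}_\epsilon(c)\to\mathbb{C}^{n+1}_\epsilon$ is the umbilical inclusion, $F=\iota\circ f$ and $i$ is the imaginary unit, defines a new horizontal isometric immersion whose induced metric has constant curvature $c$. Moreover, the solution of (1) associated to $\tilde f$ is $(\tilde v,\tilde h)$, with $$\tilde h_{ij}=h_{ij}+\langle\gamma_j,(P+P^{-1})\Omega^{-1}\gamma_i\rangle.$$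
   Context: For $\epsilon=\pm1$, $\mathbb{C}^{n+1}_\epsilon$ is complex $(n+1)$-space with the pseudo-Euclidean metric $g_\epsilon=\epsilon\,dz_1d\bar z_1+\sum_{j=2}^{n+1}dz_jd\bar z_j$, and $\mathbb{S}^{2n+1}_\epsilon(c)=\{z\in\mathbb{C}^{n+1}_\epsilon:g_\epsilon(z,z)=1/c\}$ with $\epsilon c>0$. $\tilde J$ is multiplication by the imaginary unit on $\mathbb{C}^{n+1}_\epsilon$ and $\phi$ its projection onto the tangent bundle of $\mathbb{S}^{2n+1}_\epsilon(c)$. An isometric immersion $f\colon M^n\to\mathbb{S}^{2n+1}_\epsilon(c)$ of a Riemannian manifold is horizontal if $\sqrt{|c|}\,\tilde Jf$ is everywhere normal to $f$. $\nu_f(x)$ is the dimension of the kernel of the second fundamental form $\alpha$ at $x$. $\partial_i=\partial/\partial u_i$. For such $f$, principal coordinates as in the claim exist locally. $\sigma(P)$ is the set of complex eigenvalues of $P$; superscript $t$ denotes transpose; $\varphi^t(v)=\langle\varphi,v\rangle$ and $\langle(d\varphi)^t(v),X\rangle=\langle v,d\varphi(X)\rangle$. Since $\sigma(P)\cap(-\sigma(P))=\emptyset$, the equation $P^tY+YP=C$ has a unique solution $Y$ for each endomorphism $C$ of $V$, namely $Y=(q(P^t))^{-1}\sum_{\ell=1}^ka_\ell\sum_{r=0}^{\ell-1}(-1)^r(P^t)^{\ell-1-r}CP^r$, where $q(x)=\sum_{\ell=0}^ka_\ell x^\ell$, $a_k=1$, is the characteristic polynomial of $-P$. The solution associated to $\tilde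 f$ is taken with respect to the same coordinates $u_1,\ldots,u_n$. *)

(* Defs.v *)
From HB Require Import structures.
From mathcomp Require Import all_boot all_order all_algebra.
From mathcomp Require Import complex.
From mathcomp Require Import all_classical all_reals all_analysis.

Set Implicit Arguments.
Unset Strict Implicit.
Unset Printing Implicit Defensive.

Import Order.TTheory GRing.Theory Num.Theory.
Import numFieldNormedType.Exports.

Local Open Scope classical_set_scope.
Local Open Scope ring_scope.

(* The manifold is represented by the domain U of the coordinates
   (u_1, ..., u_n), an open subset of R^n = 'rV[R]_n: a metric is a map
   'rV[R]_n -> 'M[R]_n giving its Gram matrix in the frame d/du_i, tangent
   vectors are row vectors of components in that frame, and an immersion f into
   the pseudo-sphere is given by F, f followed by the inclusion into C^(n+1).
   All maps are total; only their values on the open set at hand matter. *)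

(** Calculus *)

Definition pd (R : realType) (n : nat) (V : normedModType R) (i : 'I_n)
  (f : 'rV[R]_n -> V) : 'rV[R]_n -> V := fun x => 'D_(delta_mx 0 i) f x.

Definition iter_pd (R : realType) (n : nat) (V : normedModType R)
  (s : seq 'I_n) (f : 'rV[R]_n -> V) : 'rV[R]_n -> V :=
  foldr (fun i k => pd i k) f s.

(* C^oo: partial derivatives of every order exist and are continuous on U
   (meant for open U). *)
Definition smooth_on (R : realType) (n : nat) (V : normedModType R)
  (U : set 'rV[R]_n) (f : 'rV[R]_n -> V) : Prop :=
  forall (s : seq 'I_n) (x : 'rV[R]_n), U x ->
    {for x, continuous (iter_pd s f)} /\
    (forall i : 'I_n, derivable (iter_pd s f) x (delta_mx 0 i)).

(* R[i] carries no normed R-module structure, so complex-valued maps are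
   differentiated through their real and imaginary parts. *)
Definition re_mx (R : realType) (p : nat) (z : 'rV[R[i]]_p) : 'rV[R]_p :=
  map_mx (@complex.Re R) z.

Definition im_mx (R : realType) (p : nat) (z : 'rV[R[i]]_p) : 'rV[R]_p :=
  map_mx (@complex.Im R) z.

Definition cpd (R : realType) (n p : nat) (i : 'I_n)
  (F : 'rV[R]_n -> 'rV[R[i]]_p) : 'rV[R]_n -> 'rV[R[i]]_p :=
  fun x => \row_k Complex (pd i (fun y => re_mx (F y)) x 0 k)
                          (pd i (fun y => im_mx (F y)) x 0 k).

Definition csmooth_on (R : realType) (n p : nat) (U : set 'rV[R]_n)
  (F : 'rV[R]_n -> 'rV[R[i]]_p) : Prop :=
  smooth_on U (fun y => re_mx (F y)) /\ smooth_on U (fun y => im_mx (F y)).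

Definition differential (R : realType) (n p : nat)
  (F : 'rV[R]_n -> 'rV[R[i]]_p) (x X : 'rV[R]_n) : 'rV[R[i]]_p :=
  \sum_(i < n) ((X 0 i)%:C)%C *: cpd i F x.

(** Riemannian metrics in coordinates *)

Definition inner (R : realType) (n : nat) (g : 'rV[R]_n -> 'M[R]_n)
  (x X Y : 'rV[R]_n) : R := (X *m g x *m Y^T) 0 0.

Definition riemannian_metric (R : realType) (n : nat) (U : set 'rV[R]_n)
  (g : 'rV[R]_n -> 'M[R]_n) : Prop :=
  smooth_on U g /\
  (forall x, U x -> (g x)^T = g x /\
     (forall X : 'rV[R]_n, X != 0 -> 0 < inner g x X X)).

(* christoffel g i j k x is the coefficient of d/du_k in the Levi-Civita
   derivative of d/du_j along d/du_i. *)
Definition christoffel (R : realType) (n : nat) (g : 'rV[R]_n -> 'M[R]_n)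
  (i j k : 'I_n) (x : 'rV[R]_n) : R :=
  2^-1 * \sum_(l < n) (invmx (g x)) k l *
    (pd i g x j l + pd j g x i l - pd l g x i j).

(* Coefficient of d/du_l in R(d/du_i, d/du_j) d/du_k, with
   R(X, Y) = [nabla_X, nabla_Y] - nabla_[X, Y]. *)
Definition riemann_coef (R : realType) (n : nat) (g : 'rV[R]_n -> 'M[R]_n)
  (x : 'rV[R]_n) (i j k l : 'I_n) : R :=
  pd i (christoffel g j k l : 'rV[R]_n -> R) x
  - pd j (christoffel g i k l : 'rV[R]_n -> R) x
  + \sum_(p < n) (christoffel g i p l x * christoffel g j k p x
                  - christoffel g j p l x * christoffel g i k p x).

Definition curvature (R : realType) (n : nat) (g : 'rV[R]_n -> 'M[R]_n)
  (x X Y Z : 'rV[R]_n) : 'rV[R]_n :=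
  \row_l \sum_(i < n) \sum_(j < n) \sum_(k < n)
     X 0 i * Y 0 j * Z 0 k * riemann_coef g x i j k l.

Definition sectional (R : realType) (n : nat) (g : 'rV[R]_n -> 'M[R]_n)
  (x X Y : 'rV[R]_n) : R :=
  inner g x (curvature g x X Y Y) X /
  (inner g x X X * inner g x Y Y - inner g x X Y ^+ 2).

Definition constant_curvature (R : realType) (n : nat) (U : set 'rV[R]_n)
  (g : 'rV[R]_n -> 'M[R]_n) (c : R) : Prop :=
  forall x X Y : 'rV[R]_n, U x -> row_free (col_mx X Y) ->
    sectional g x X Y = c.

(** Pseudo-Euclidean space and its pseudo-spheres *)

Definition geps (R : realType) (n : nat) (eps : R) (z w : 'rV[R[i]]_n.+1) : R :=
  complex.Re ((eps%:C)%C * (z 0 ord0 * conjc (w 0 ord0))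
     + \sum_(j < n.+1 | j != ord0) z 0 j * conjc (w 0 j)).

Definition pseudosphere (R : realType) (n : nat) (eps c : R) :
  set 'rV[R[i]]_n.+1 := [set z | geps eps z z = c^-1].

Definition Jmul (R : realType) (n : nat) (z : 'rV[R[i]]_n.+1) :
  'rV[R[i]]_n.+1 := ('i)%C *: z.

(* Orthogonal projection onto the tangent space of the pseudo-sphere at z,
   whose normal line is spanned by z with geps eps z z = 1/c. *)
Definition tangent_proj (R : realType) (n : nat) (eps c : R)
  (z w : 'rV[R[i]]_n.+1) : 'rV[R[i]]_n.+1 :=
  w - ((c * geps eps w z)%:C)%C *: z.

Definition phi_tensor (R : realType) (n : nat) (eps c : R)
  (z w : 'rV[R[i]]_n.+1) : 'rV[R[i]]_n.+1 := tangent_proj eps c z (Jmul w).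

(** Immersions into the pseudo-sphere *)

Definition isometric_immersion (R : realType) (n : nat) (eps c : R)
  (U : set 'rV[R]_n) (g : 'rV[R]_n -> 'M[R]_n)
  (F : 'rV[R]_n -> 'rV[R[i]]_n.+1) : Prop :=
  [/\ csmooth_on U F,
      forall x, U x -> pseudosphere eps c (F x),
      forall x X : 'rV[R]_n, U x -> differential F x X = 0 -> X = 0 &
      forall x X Y : 'rV[R]_n, U x ->
        geps eps (differential F x X) (differential F x Y) = inner g x X Y].

Definition induced_metric (R : realType) (n : nat) (eps : R)
  (F : 'rV[R]_n -> 'rV[R[i]]_n.+1) : 'rV[R]_n -> 'M[R]_n :=
  fun x => \matrix_(i, j) geps eps (cpd i F x) (cpd j F x).

Definition horizontal (R : realType) (n : nat) (eps c : R)
  (U : set 'rV[R]_n) (F : 'rV[R]_n -> 'rV[R[i]]_n.+1) : Prop :=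
  forall x X : 'rV[R]_n, U x ->
    geps eps (((Num.sqrt `|c|)%:C)%C *: Jmul (F x)) (differential F x X) = 0.

(* alpha(d/du_i, d/du_j) by the Gauss formula: the Levi-Civita connection of
   the pseudo-sphere is the tangential part of the flat one, and the
   Levi-Civita connection of g is subtracted. *)
Definition second_ff (R : realType) (n : nat) (eps c : R)
  (g : 'rV[R]_n -> 'M[R]_n) (F : 'rV[R]_n -> 'rV[R[i]]_n.+1)
  (x : 'rV[R]_n) (i j : 'I_n) : 'rV[R[i]]_n.+1 :=
  tangent_proj eps c (F x) (cpd i (cpd j F) x)
  - \sum_(k < n) ((christoffel g i j k x)%:C)%C *: cpd k F x.

(* Dimension of {X | alpha(X, d/du_j) = 0 for all j}. *)
Definition relative_nullity (R : realType) (n : nat) (eps c : R)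
  (g : 'rV[R]_n -> 'M[R]_n) (F : 'rV[R]_n -> 'rV[R[i]]_n.+1)
  (x : 'rV[R]_n) : nat :=
  \rank (\bigcap_(j < n) kermx
    (\matrix_(i < n) row_mx (re_mx (second_ff eps c g F x i j))
                            (im_mx (second_ff eps c g F x i j))))%MS.

(** Principal coordinates and the associated solution *)

Definition solves_hv_system (R : realType) (n : nat) (c : R)
  (U : set 'rV[R]_n) (v : 'I_n -> 'rV[R]_n -> R)
  (h : 'I_n -> 'I_n -> 'rV[R]_n -> R) : Prop :=
  [/\ (forall i, smooth_on U (v i : 'rV[R]_n -> R)) /\
      (forall i j, i != j -> smooth_on U (h i j : 'rV[R]_n -> R)),
      forall i j x, U x -> i != j -> pd j (v i) x = h j i x * v j x,
      forall i j x, U x -> i != j ->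
        \sum_(l < n) pd l (h i j) x + c * v i x * v j x = 0 &
      forall i j l x, U x -> l != i -> i != j -> j != l ->
        pd l (h i j) x = h i l x * h j l x].

(* Only off-diagonal h i j are meaningful.  The v i are required to be nonzero
   rather than positive, since the transformed functions need not be positive;
   positivity is a separate hypothesis on the initial ones. *)
Definition associated_solution (R : realType) (n : nat) (eps c : R)
  (U : set 'rV[R]_n) (g : 'rV[R]_n -> 'M[R]_n)
  (F : 'rV[R]_n -> 'rV[R[i]]_n.+1)
  (v : 'I_n -> 'rV[R]_n -> R) (h : 'I_n -> 'I_n -> 'rV[R]_n -> R) : Prop :=
  [/\ forall i x, U x -> v i x != 0,
      forall i j x, U x -> g x i j = if i == j then v i x ^+ 2 else 0,
      forall i j x, U x -> second_ff eps c g F x i j =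
        if i == j then phi_tensor eps c (F x) (cpd i F x) else 0,
      forall i j x, U x -> i != j ->
        h i j x = h j i x /\ h i j x = (v i x)^-1 * pd i (v j) x &
      solves_hv_system c U v h].

(** Data of the transformation; the Euclidean space V is 'cV[R]_m *)

Definition dotv (R : realType) (m : nat) (a b : 'cV[R]_m) : R :=
  (a^T *m b) 0 0.

(* The complex spectrum of P is disjoint from its opposite. *)
Definition spectrum_condition (R : realType) (m : nat) (P : 'M[R]_m) : Prop :=
  forall l : R[i], eigenvalue (map_mx (real_complex R) P) l ->
    ~~ eigenvalue (map_mx (real_complex R) P) (- l).

Definition solves_linear_system (R : realType) (n m : nat) (c : R)
  (W : set 'rV[R]_n) (v : 'I_n -> 'rV[R]_n -> R)
  (h : 'I_n -> 'I_n -> 'rV[R]_n -> R) (P : 'M[R]_m)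
  (phi : 'rV[R]_n -> 'cV[R]_m) (gam : 'I_n -> 'rV[R]_n -> 'cV[R]_m) : Prop :=
  [/\ smooth_on W phi /\ (forall i, smooth_on W (gam i)),
      forall i x, W x -> pd i phi x = v i x *: gam i x,
      forall i j x, W x -> i != j -> pd i (gam j) x = h j i x *: gam i x &
      forall i x, W x ->
        pd i (gam i) x + \sum_(j < n | j != i) h j i x *: gam j x
        + invmx (P^T) *m gam i x + (c * v i x) *: phi x = 0].

Definition jacobian (R : realType) (n m : nat) (phi : 'rV[R]_n -> 'cV[R]_m)
  (x : 'rV[R]_n) : 'M[R]_(m, n) := \matrix_(k, i) pd i phi x k 0.

(* Adjoint of the differential of phi for the metric g on the source:
   <(dphi)^t w, X>_g = <w, dphi X>. *)
Definition jacobian_adj (R : realType) (n m : nat) (g : 'rV[R]_n -> 'M[R]_n)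
  (phi : 'rV[R]_n -> 'cV[R]_m) (x : 'rV[R]_n) : 'M[R]_(n, m) :=
  invmx (g x) *m (jacobian phi x)^T.

Definition sylvester_solution (R : realType) (n m : nat) (c : R)
  (g : 'rV[R]_n -> 'M[R]_n) (P : 'M[R]_m) (phi : 'rV[R]_n -> 'cV[R]_m)
  (x : 'rV[R]_n) (Y : 'M[R]_m) : Prop :=
  P^T *m Y + Y *m P =
  (P^T *m P^T + 1%:M)
  *m (jacobian phi x *m jacobian_adj g phi x + c *: (phi x *m (phi x)^T)) *m P.

Definition v_tilde (R : realType) (n m : nat) (v : 'I_n -> 'rV[R]_n -> R)
  (P : 'M[R]_m) (phi : 'rV[R]_n -> 'cV[R]_m)
  (gam : 'I_n -> 'rV[R]_n -> 'cV[R]_m) (Omega : 'rV[R]_n -> 'M[R]_m)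
  (i : 'I_n) (x : 'rV[R]_n) : R :=
  v i x + dotv (gam i x) ((P + invmx P) *m invmx (Omega x) *m phi x).

Definition h_tilde (R : realType) (n m : nat)
  (h : 'I_n -> 'I_n -> 'rV[R]_n -> R)
  (P : 'M[R]_m) (gam : 'I_n -> 'rV[R]_n -> 'cV[R]_m)
  (Omega : 'rV[R]_n -> 'M[R]_m) (i j : 'I_n) (x : 'rV[R]_n) : R :=
  h i j x + dotv (gam j x) ((P + invmx P) *m invmx (Omega x) *m gam i x).

Definition F_tilde (R : realType) (n m : nat) (c : R)
  (F : 'rV[R]_n -> 'rV[R[i]]_n.+1) (v : 'I_n -> 'rV[R]_n -> R)
  (P : 'M[R]_m) (phi : 'rV[R]_n -> 'cV[R]_m)
  (gam : 'I_n -> 'rV[R]_n -> 'cV[R]_m) (Omega : 'rV[R]_n -> 'M[R]_m)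
  (x : 'rV[R]_n) : 'rV[R[i]]_n.+1 :=
  F x
  - \sum_(j < n)
      Complex (dotv (invmx (Omega x) *m phi x) (gam j x))
              (dotv (P *m invmx (Omega x) *m phi x) (gam j x))
      *: ((((v j x)^-1)%:C)%C *: cpd j F x)
  - Complex (dotv (invmx (Omega x) *m phi x) (phi x))
            (dotv (P *m invmx (Omega x) *m phi x) (phi x))
    *: ((c%:C)%C *: F x).

(* Main.v *)
Require Import Defs.
From mathcomp Require Import all_boot all_order all_algebra.
From mathcomp Require Import complex ring.
From mathcomp Require Import all_classical all_reals all_analysis.
Import Order.TTheory GRing.Theory Num.Theory.
Import numFieldNormedType.Exports.
Local Open Scope classical_set_scope.
Local Open Scope ring_scope.

(** In principal coordinates a horizontal isometric immersion of constant
    curvature is the same thing as a solution of a linear system. Put F and the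
    orthonormal vectors e_j = F_* X_j as the rows of a square complex matrix Psi.
    Then d_i Psi = A_i Psi + i E_i Psi, where i without index is the imaginary
    unit, E_i is the projection onto the i-th tangent leg and A_i is a real matrix
    built from (v, h), skew for the form J = diag(c, 1, ..., 1); moreover Psi H
    Psi^* = J^-1 for the ambient pseudo-Hermitian form H. The data (phi, gamma_j),
    taken as the rows of Phi, satisfy the same system with the imaginary unit
    replaced by -Q acting on the right, Q = P^-1: d_i Phi = A_i Phi - E_i Phi Q.

    The transformation is a dressing of Psi by Phi. Let D = Phi^T J Phi, which is
    the sum of the gamma_j gamma_j^t and of c phi phi^t. The matrix N = Omega (P +
    Q)^-1 solves the Sylvester equation N Q + Q^T N = D; since the solution is
    unique, N is symmetric and d_i N = - Phi^T E_i Phi. With M = N^-1 and L = M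
    (Q^T - i)^-1, the transformed frame is Psi' = Psi - Phi L Phi^T J Psi, whose
    first row is the map of the theorem. Two identities between matrices do all
    the work. The identity L D L^* = L + L^* gives Psi' H Psi'^* = J^-1. The
    identity Q M + M Q^T = M D M gives d_i Psi' = A'_i Psi' + i E_i Psi' with A'_i
    = A_i + S E_i - E_i S J and S = Phi M Phi^T; and A'_i is the matrix built from
    v'_j = v_j + S_0j and h'_jk = h_jk + S_jk, which are the functions v-tilde and
    h-tilde (frame_conn_dress, dressing_derive, dressing_gram,
    tilde_moving_frame).

    The system for (v', h') follows from the derivative of S (pd_S,
    tilde_solves_hv). It remains to pass between immersions and frames. From F to
    Psi (associated_structure, structure_frame), the second fundamental form and
    the Christoffel symbols of the diagonal metric give the Gauss formula d_i d_j
    F = sum_k Gamma_ij^k d_k F - c g_ij F + delta_ij i d_i F. From Psi' back to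
    the immersion (frame_structure, principal_conclusions), the Gauss formula and
    the orthonormality of the frame give everything except the curvature. That
    comes from the symmetry in l and i of d_l d_i d_j F paired with the frame: the
    terms with delta_ij are symmetric by themselves, and so the induced metric has
    the same curvature c as the ambient pseudo-sphere (principal_riemann). *)

Set Implicit Arguments.
Unset Strict Implicit.
Unset Printing Implicit Defensive.

(** * Smooth functions and their closure properties *)

Section SmoothClosure.
Variables (R : realType) (n : nat).
Implicit Types (U : set 'rV[R]_n) (x : 'rV[R]_n) (i : 'I_n).

Lemma near_eq_open (T : Type) U (f g : 'rV[R]_n -> T) x :
  open U -> U x -> (forall y, U y -> f y = g y) -> \near x, f x = g x.
Proof.
move=> oU Ux fg.
have := open_nbhs_nbhs (conj oU Ux).
by apply: filterS => y; exact: fg.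
Qed.

(** Continuity and existence of the partial derivatives, that is, the
    condition that smoothness imposes on every iterated derivative. *)
Definition C1_at (V : normedModType R) (f : 'rV[R]_n -> V) x :=
  {for x, continuous f} /\ forall i, derivable f x (delta_mx 0 i).

Lemma C1_at_eq (V : normedModType R) U (f g : 'rV[R]_n -> V) x :
  open U -> U x -> (forall y, U y -> f y = g y) -> C1_at f x -> C1_at g x.
Proof.
move=> oU Ux fg [cf df]; have nfg := near_eq_open oU Ux fg; split.
  rewrite /prop_for /continuous_at -(fg x Ux); apply: cvg_trans cf.
  exact: near_eq_cvg nfg.
by move=> i; exact: near_eq_derivable (df i).
Qed.

Lemma pd_eq (V : normedModType R) U (f g : 'rV[R]_n -> V) i x :
  open U -> U x -> (forall y, U y -> f y = g y) -> pd i f x = pd i g x.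
Proof. by move=> oU Ux fg; apply: near_eq_derive; exact: near_eq_open fg. Qed.

(** Smoothness is the largest class of C1 functions stable under partial
    derivatives. To show that a family is smooth it is enough that its
    derivatives stay in the family, up to equality on the open set U; this
    avoids any bookkeeping of the order of derivation. *)
Lemma smooth_coind (V : normedModType R) U (S : ('rV[R]_n -> V) -> Prop) :
  open U ->
  (forall f x, S f -> U x -> C1_at f x) ->
  (forall f i, S f -> exists2 g, S g & forall x, U x -> pd i f x = g x) ->
  forall f, S f -> smooth_on U f.
Proof.
move=> oU S_symE Spd f Sf s.
have [g Sg fg] : exists2 g, S g & forall x, U x -> iter_pd s f x = g x.
  elim: s => [|i s [g Sg fg]] /=; first by exists f.
  have [g' Sg' gg'] := Spd g i Sg.
  by exists g' => // x Ux; rewrite -gg'//; exact: pd_eq oU Ux fg.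
move=> x Ux; have := S_symE g x Sg Ux; apply: C1_at_eq oU Ux _.
by move=> y Uy; rewrite fg.
Qed.

Lemma smooth_on_C1 (V : normedModType R) U (f : 'rV[R]_n -> V) x :
  smooth_on U f -> U x -> C1_at f x.
Proof. by move=> sf Ux; exact: (sf [::]). Qed.

Lemma smooth_on_pd (V : normedModType R) U (f : 'rV[R]_n -> V) i :
  smooth_on U f -> smooth_on U (pd i f).
Proof.
by move=> sf s x Ux; have := sf (rcons s i) x Ux; rewrite /iter_pd foldr_rcons.
Qed.

Lemma smooth_on_eq (V : normedModType R) U (f g : 'rV[R]_n -> V) :
  open U -> (forall y, U y -> f y = g y) -> smooth_on U f -> smooth_on U g.
Proof.
move=> oU fg sf.
apply: (@smooth_coind _ U
  (fun k => exists2 f0, smooth_on U f0 & forall y, U y -> f0 y = k y)) => //.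
- move=> k x [f0 sf0 e] Ux; by apply: (C1_at_eq oU Ux e); exact: smooth_on_C1 sf0 Ux.
- move=> k i [f0 sf0 e]; exists (pd i f0).
    by exists (pd i f0) => //; exact: smooth_on_pd.
  by move=> x Ux; apply: pd_eq oU Ux _ => y Uy; rewrite e.
- by exists f.
Qed.

Lemma smooth_on_sub (V : normedModType R) U (W : set 'rV[R]_n)
  (f : 'rV[R]_n -> V) : W `<=` U -> smooth_on U f -> smooth_on W f.
Proof. by move=> WU sf s x /WU; exact: sf. Qed.

Lemma is_derive_pd (V : normedModType R) U (f : 'rV[R]_n -> V) i x :
  smooth_on U f -> U x -> is_derive x (delta_mx 0 i) f (pd i f x).
Proof. by move=> sf Ux; apply: derivableP; exact: (smooth_on_C1 sf Ux).2. Qed.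

(** Formal closure of the smooth functions under ring operations and inverses.
    The product and quotient rules keep derivatives in this class, so that a
    single coinduction proves all closure properties at once. *)
Inductive smooth_expr U : ('rV[R]_n -> R) -> Prop :=
| SmoothAtom f : smooth_on U f -> smooth_expr U f
| SmoothCst a : smooth_expr U (fun=> a)
| SmoothAdd f g : smooth_expr U f -> smooth_expr U g ->
    smooth_expr U (fun y => f y + g y)
| SmoothMul f g : smooth_expr U f -> smooth_expr U g ->
    smooth_expr U (fun y => f y * g y)
| SmoothInv f : smooth_expr U f -> (forall y, U y -> f y != 0) ->
    smooth_expr U (fun y => (f y)^-1).

Lemma smooth_expr_C1 U f x : smooth_expr U f -> U x -> C1_at f x.
Proof.
move=> ef Ux; elim: ef => {f} [f sf|a|f g _ [cf df] _ [cg dg]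
  |f g _ [cf df] _ [cg dg]|f _ [cf df] f0].
- exact: smooth_on_C1 Ux.
- by split => [|i]; [exact: cst_continuous|exact: derivable_cst].
- by split => [|i]; [exact: continuousD|exact: derivableD].
- by split => [|i]; [exact: continuousM|exact: derivableM].
- by split => [|i]; [apply: continuousV|apply: derivableV] => //; exact: f0.
Qed.

Lemma smooth_expr_pd U f i : smooth_expr U f ->
  exists2 g, smooth_expr U g & forall x, U x -> pd i f x = g x.
Proof.
elim=> {f} [f sf|a|f g ef [f' ef' ff'] eg [g' eg' gg']
  |f g ef [f' ef' ff'] eg [g' eg' gg']|f ef [f' ef' ff'] f0].
- by exists (pd i f) => //; apply: SmoothAtom; exact: smooth_on_pd.
- exists (fun=> 0); first exact: SmoothCst.
  by move=> x _; rewrite /pd derive_cst.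
- exists (fun y => f' y + g' y); first exact: SmoothAdd.
  move=> x Ux; rewrite -ff'// -gg'//.
  by apply: deriveD; apply: (smooth_expr_C1 _ Ux).2.
- exists (fun y => f y * g' y + g y * f' y).
    by apply: SmoothAdd; exact: SmoothMul.
  move=> x Ux; rewrite -ff'// -gg'//.
  by apply: deriveM; apply: (smooth_expr_C1 _ Ux).2.
- exists (fun y => (-1) * ((f y)^-1 * (f y)^-1) * f' y).
    apply: SmoothMul => //; apply: SmoothMul; first exact: SmoothCst.
    by apply: SmoothMul; exact: SmoothInv.
  move=> x Ux; rewrite -ff'// {1}/pd deriveV ?f0//.
    by rewrite -invfM -expr2 mulN1r; congr (_ * _); rewrite -exprVn.
  exact: (smooth_expr_C1 ef Ux).2.
Qed.

Lemma smooth_exprP U f : open U -> smooth_expr U f -> smooth_on U f.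
Proof.
move=> oU; apply: (smooth_coind oU) => {f} f.
- by move=> x; exact: smooth_expr_C1.
- by move=> i; exact: smooth_expr_pd.
Qed.

End SmoothClosure.

(** * Symmetry of second partial derivatives *)

Section Schwarz.
Variables (R : realType) (n : nat).
Implicit Types (U : set 'rV[R]_n) (x p u w : 'rV[R]_n) (i : 'I_n).

Lemma is_derive_line (f : 'rV[R]_n -> R) p u (s : R) :
  derivable f (s *: u + p) u ->
  is_derive s 1 (fun t : R => f (t *: u + p)) ('D_u f (s *: u + p)).
Proof.
have E : (fun h : R => h^-1 *: (((fun t : R => f (t *: u + p)) \o shift s)
            (h *: 1) - f (s *: u + p)))
       = (fun h => h^-1 *: ((f \o shift (s *: u + p)) (h *: u)
            - f (s *: u + p))).
  by apply/funext => h /=; rewrite [h%:A]mulr1 scalerDl addrA.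
by move=> df; split; rewrite /derivable /derive E.
Qed.

Lemma MVT_line (f : 'rV[R]_n -> R) p u (d : R) : 0 < d ->
  (forall s, 0 <= s <= d -> derivable f (s *: u + p) u) ->
  exists2 s, 0 <= s <= d & f (d *: u + p) - f p = d * 'D_u f (s *: u + p).
Proof.
move=> d0 df.
have isd s : 0 <= s <= d ->
    is_derive s 1 (fun t : R => f (t *: u + p)) ('D_u f (s *: u + p)).
  by move=> sd; apply: is_derive_line; exact: df.
have [s|s|s sd] := @MVT R (fun t => f (t *: u + p))
  (fun t => 'D_u f (t *: u + p)) 0 d d0.
- by rewrite in_itv /= => /andP[s0 s1]; apply: isd; rewrite !ltW.
- have := @derivable_within_continuous R R (fun t => f (t *: u + p)) `[0, d].
  by apply => t; rewrite in_itv /= => /isd [].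
rewrite scale0r add0r subr0 mulrC => e; exists s => //.
by move: sd; rewrite in_itv /= => /andP[s0 s1]; rewrite !ltW.
Qed.

Lemma derivable_shift (f : 'rV[R]_n -> R) a p u :
  derivable f (p + a) u -> derivable (fun y => f (y + a)) p u.
Proof.
have E : (fun h : R => h^-1 *: (((fun y => f (y + a)) \o shift p) (h *: u)
            - f (p + a)))
       = (fun h => h^-1 *: ((f \o shift (p + a)) (h *: u) - f (p + a))).
  by apply/funext => h /=; rewrite addrA.
by rewrite /derivable E.
Qed.

Lemma derive_shift_fun (f : 'rV[R]_n -> R) a p u :
  'D_u (fun y => f (y + a)) p = 'D_u f (p + a).
Proof.
have E : (fun h : R => h^-1 *: (((fun y => f (y + a)) \o shift p) (h *: u)
            - f (p + a)))
       = (fun h => h^-1 *: ((f \o shift (p + a)) (h *: u) - f (p + a))).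
  by apply/funext => h /=; rewrite addrA.
by rewrite /derive E.
Qed.

(** The mean value theorem, applied first in the direction u to the increment
    of f in the direction w and then in the direction w, writes the second
    difference of f as a mixed derivative at an intermediate point. *)
Lemma second_difference (f : 'rV[R]_n -> R) x u w (d : R) : 0 < d ->
  (forall s t, 0 <= s <= d -> 0 <= t <= d ->
     derivable f (s *: u + t *: w + x) u /\
     derivable ('D_u f) (s *: u + t *: w + x) w) ->
  exists s t, [/\ 0 <= s <= d, 0 <= t <= d &
    f (d *: u + d *: w + x) - f (d *: u + x) - f (d *: w + x) + f x
    = d * d * 'D_w ('D_u f) (s *: u + t *: w + x)].
Proof.
move=> d0 df; have d00 : 0 <= (0 : R) <= d by rewrite lexx ltW.
have d0d : 0 <= d <= d by rewrite lexx ltW.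
have df1 s : 0 <= s <= d -> derivable f (s *: u + x) u.
  by move=> sd; have [+ _] := df s 0 sd d00; rewrite scale0r addr0.
have df2 s : 0 <= s <= d ->
    derivable (fun y => f (y + d *: w)) (s *: u + x) u.
  move=> sd; apply: derivable_shift; have [+ _] := df s d sd d0d.
  by rewrite addrAC.
have [s sd e] := @MVT_line (fun y => f (y + d *: w) - f y) x u d d0
  (fun s sd => derivableB (df2 s sd) (df1 s sd)).
have [t td e'] := @MVT_line ('D_u f) (s *: u + x) w d d0 (fun t td =>
  eq_ind _ (fun z => derivable _ z _) (df s t sd td).2 _
    (etrans (congr1 (fun z => z + x) (addrC _ _)) (esym (addrA _ _ _)))).
exists s, t; split; [exact: sd|exact: td|].
rewrite deriveB in e; [|exact: df2|exact: df1].
rewrite derive_shift_fun (addrC (s *: u + x) (d *: w)) e' in e.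
rewrite -mulrA (_ : s *: u + t *: w + x = t *: w + (s *: u + x)); last first.
  by rewrite addrA [t *: w + _]addrC.
rewrite -e (_ : d *: u + x + d *: w = d *: u + d *: w + x); last by rewrite addrAC.
by rewrite (addrC x); ring.
Qed.

(** The second difference is symmetric in the two directions, hence both mixed
    derivatives take the same value at two points close to x. Letting the step
    go to zero, their continuity gives the equality at x. *)
Lemma pd_comm U (f : 'rV[R]_n -> R) i j x :
  open U -> smooth_on U f -> U x -> pd i (pd j f) x = pd j (pd i f) x.
Proof.
move=> oU sf Ux; apply/eqP; rewrite -subr_eq0 -normr_le0.
apply/ler_addgt0Pr => e e0; rewrite add0r.
have near_mixed k l : \forall y \near x,
    `|pd k (pd l f) x - pd k (pd l f) y| < e / 2.
  have [c _] : C1_at (pd k (pd l f)) x.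
    by apply: smooth_on_C1 Ux; do 2!apply: smooth_on_pd.
  by move/cvgrPdist_lt : c => /(_ (e / 2)); apply; rewrite divr_gt0.
have nU : \forall y \near x, U y by exact: open_nbhs_nbhs.
have nall : \forall y \near x, [/\ U y,
    `|pd i (pd j f) x - pd i (pd j f) y| < e / 2 &
    `|pd j (pd i f) x - pd j (pd i f) y| < e / 2].
  by apply: filterS3 nU (near_mixed i j) (near_mixed j i) => y; split.
case/nbhs_ballP: nall => r /= r0 rP.
set u : 'rV[R]_n := delta_mx 0 j; set w : 'rV[R]_n := delta_mx 0 i.
(* A step so small that the parallelogram spanned by d u and d w stays in the
   ball of radius r. *)
pose d := r / 2 / (`|u| + `|w| + 1).
have uw : 0 < `|u| + `|w| + 1 by rewrite ltr_pwDr// addr_ge0.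
have d0 : 0 < d by rewrite !divr_gt0.
have inball s t : 0 <= s <= d -> 0 <= t <= d -> ball x r (s *: u + t *: w + x).
  move=> /andP[s0 sd] /andP[t0 td]; rewrite -ball_normE /ball_ /=.
  rewrite opprD addrCA subrr addr0 normrN.
  apply: le_lt_trans (ler_normD _ _) _; rewrite !normrZ !ger0_norm//.
  apply: (@le_lt_trans _ _ (d * (`|u| + `|w|))).
    by rewrite mulrDr lerD// ler_wpM2r.
  apply: (@lt_trans _ _ (d * (`|u| + `|w| + 1))).
    by rewrite ltr_pM2l// ltrDl.
  by rewrite /d mulfVK ?gt_eqF// gtr_pMr// invf_lt1// ltr1n.
have [|s [t [sd td e1]]] := @second_difference f x u w d d0.
  move=> s t sd td; have [Uy _ _] := rP _ (inball s t sd td).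
  split; first exact: (smooth_on_C1 sf Uy).2.
  exact: (smooth_on_C1 (smooth_on_pd _ sf) Uy).2.
have [|t' [s' [td' sd' e2]]] := @second_difference f x w u d d0.
  move=> t' s' td' sd'; have := inball s' t' sd' td'.
  rewrite [s' *: u + _]addrC => /rP[Uy _ _].
  split; first exact: (smooth_on_C1 sf Uy).2.
  exact: (smooth_on_C1 (smooth_on_pd _ sf) Uy).2.
have [_ + _] := rP _ (inball s t sd td).
have [_ _ +] := rP _ (inball s' t' sd' td').
have -> : pd i (pd j f) (s *: u + t *: w + x)
        = pd j (pd i f) (s' *: u + t' *: w + x).
  have dd : d * d != 0 by rewrite mulf_neq0// gt_eqF.
  apply: (mulfI dd); rewrite [s' *: u + _]addrC.
  apply: etrans (esym e1) _; apply: etrans e2.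
  by rewrite [d *: w + d *: u]addrC; ring.
(* Here z is the common value of the two mixed derivatives near x. *)
have tri (a b z : R) : `|b - z| < e / 2 -> `|a - z| < e / 2 -> `|a - b| <= e.
  move=> bz az; have -> : a - b = (a - z) - (b - z) by ring.
  by rewrite (le_trans (ler_normB _ _))// (splitr e) lerD// ltW.
exact: tri.
Qed.

End Schwarz.

(** * Calculus of matrix-valued maps *)

Section ComplexParts.
Variable R : realType.
Implicit Types z w : R[i].

Lemma ReD z w : complex.Re (z + w) = complex.Re z + complex.Re w.
Proof. by case: z w => [a b] [a' b']. Qed.
Lemma ImD z w : complex.Im (z + w) = complex.Im z + complex.Im w.
Proof. by case: z w => [a b] [a' b']. Qed.
Lemma ReN z : complex.Re (- z) = - complex.Re z.
Proof. by case: z. Qed.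
Lemma ImN z : complex.Im (- z) = - complex.Im z.
Proof. by case: z. Qed.
Lemma ReM z w : complex.Re (z * w)
  = complex.Re z * complex.Re w + (-1) * (complex.Im z * complex.Im w).
Proof. by case: z w => [a b] [a' b'] /=; rewrite mulN1r. Qed.
Lemma ImM z w : complex.Im (z * w)
  = complex.Re z * complex.Im w + complex.Im z * complex.Re w.
Proof. by case: z w => [a b] [a' b'] /=. Qed.
Lemma Re_sum (I : Type) (r : seq I) (P : pred I) (f : I -> R[i]) :
  complex.Re (\sum_(k <- r | P k) f k) = \sum_(k <- r | P k) complex.Re (f k).
Proof. exact: (big_morph _ ReD). Qed.
Lemma Im_sum (I : Type) (r : seq I) (P : pred I) (f : I -> R[i]) :
  complex.Im (\sum_(k <- r | P k) f k) = \sum_(k <- r | P k) complex.Im (f k).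
Proof. exact: (big_morph _ ImD). Qed.

Lemma complex_eq z w : complex.Re z = complex.Re w ->
  complex.Im z = complex.Im w -> z = w.
Proof. by case: z w => [a b] [a' b'] /= -> ->. Qed.

End ComplexParts.

Section ComplexCalculus.
Variables (R : realType) (n : nat).
Local Notation C := R[i].
Implicit Types (U : set 'rV[R]_n) (x : 'rV[R]_n) (i : 'I_n).

Lemma smooth_sum U (I : Type) (r : seq I) (P : pred I) (f : I -> 'rV[R]_n -> R) :
  open U -> (forall k, P k -> smooth_on U (f k)) ->
  smooth_on U (fun y => \sum_(k <- r | P k) f k y).
Proof.
move=> oU sf; elim: r => [|k r IH].
  apply: smooth_exprP => //.
  rewrite [X in smooth_expr _ X](_ : _ = fun=> 0); first exact: SmoothCst.
  by apply/funext => y; rewrite big_nil.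
rewrite [X in smooth_on _ X](_ : _ = fun y =>
  (if P k then f k y else 0) + \sum_(k <- r | P k) f k y); last first.
  by apply/funext => y; rewrite big_cons; case: ifP; rewrite ?add0r.
apply: smooth_exprP => //; apply: SmoothAdd; last exact: SmoothAtom.
by case Pk: (P k); [apply: SmoothAtom; exact: sf|exact: SmoothCst].
Qed.

Lemma smooth_prod U (I : Type) (r : seq I) (P : pred I) (f : I -> 'rV[R]_n -> R) :
  open U -> (forall k, P k -> smooth_on U (f k)) ->
  smooth_on U (fun y => \prod_(k <- r | P k) f k y).
Proof.
move=> oU sf; elim: r => [|k r IH].
  apply: smooth_exprP => //.
  rewrite [X in smooth_expr _ X](_ : _ = fun=> 1); first exact: SmoothCst.
  by apply/funext => y; rewrite big_nil.
rewrite [X in smooth_on _ X](_ : _ = fun y =>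
  (if P k then f k y else 1) * \prod_(k <- r | P k) f k y); last first.
  by apply/funext => y; rewrite big_cons; case: ifP; rewrite ?mul1r.
apply: smooth_exprP => //; apply: SmoothMul; last exact: SmoothAtom.
by case Pk: (P k); [apply: SmoothAtom; exact: sf|exact: SmoothCst].
Qed.

Lemma smooth_cst U (a : R) : open U -> smooth_on U (fun=> a : R).
Proof. by move=> oU; apply: smooth_exprP => //; exact: SmoothCst. Qed.

Lemma smoothD U (f g : 'rV[R]_n -> R) : open U ->
  smooth_on U f -> smooth_on U g -> smooth_on U (fun y => f y + g y).
Proof. by move=> oU *; apply: smooth_exprP => //; apply: SmoothAdd; exact: SmoothAtom. Qed.

Lemma smoothM U (f g : 'rV[R]_n -> R) : open U ->
  smooth_on U f -> smooth_on U g -> smooth_on U (fun y => f y * g y).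
Proof. by move=> oU *; apply: smooth_exprP => //; apply: SmoothMul; exact: SmoothAtom. Qed.

Lemma smoothN U (f : 'rV[R]_n -> R) : open U ->
  smooth_on U f -> smooth_on U (fun y => - f y).
Proof.
move=> oU sf; rewrite [X in smooth_on _ X](_ : _ = fun y => (-1) * f y).
  exact: (smoothM oU (smooth_cst (-1) oU) sf).
by apply/funext => y; rewrite mulN1r.
Qed.

Lemma smoothV U (f : 'rV[R]_n -> R) : open U ->
  smooth_on U f -> (forall y, U y -> f y != 0) ->
  smooth_on U (fun y => (f y)^-1).
Proof. by move=> oU *; apply: smooth_exprP => //; apply: SmoothInv => //; exact: SmoothAtom. Qed.

Lemma pd_mxE (p q : nat) (A : 'rV[R]_n -> 'M[R]_(p, q)) i x k l :
  (forall k l, derivable (fun y => A y k l) x (delta_mx 0 i)) ->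
  pd i A x k l = pd i (fun y => A y k l) x.
Proof. by move=> dA; rewrite /pd derive_mx ?mxE//; apply/derivable_mxP. Qed.

Lemma continuous_mxP (p q : nat) (A : 'rV[R]_n -> 'M[R]_(p, q)) x :
  {for x, continuous A} <->
  forall k l, {for x, continuous (fun y => A y k l)}.
Proof.
split=> [cA k l|cA].
  exact: (continuous_comp cA (@coord_continuous _ _ _ k l (A x))).
apply: (@cvgrPdist_le _ _ _ (nbhs x) _ A (A x)).2 => e e0.
have : \forall y \near x, forall kl : 'I_p * 'I_q,
    `|A x kl.1 kl.2 - A y kl.1 kl.2| <= e.
  apply: (@filter_forall _ _ _ (nbhs x)) => kl.
  exact: ((@cvgrPdist_le _ _ _ (nbhs x) _ (fun y => A y kl.1 kl.2)
    (A x kl.1 kl.2)).1 (cA kl.1 kl.2) e e0).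
apply: (@filterS _ (nbhs x)) => y Ay.
rewrite /Num.Def.normr/= mx_normrE (bigmax_le _ (ltW e0))//= => kl _.
by rewrite !mxE/=; exact: Ay.
Qed.

(** The norm on matrices is a maximum over the entries, hence smoothness can
    be read off entrywise. *)
Lemma smooth_mxP U (p q : nat) (A : 'rV[R]_n -> 'M[R]_(p, q)) : open U ->
  smooth_on U A <-> forall k l, smooth_on U (fun y => A y k l).
Proof.
move=> oU; split=> [sA k l|sA].
  apply: (@smooth_coind _ _ _ U (fun f => exists2 B : 'rV[R]_n -> 'M[R]_(p, q),
     smooth_on U B & f = fun y => B y k l)) => //; last by exists A.
    move=> f x [B sB ->] Ux; have [cB dB] := smooth_on_C1 sB Ux; split.
      exact: (continuous_mxP _ _).1.
    by move=> i; have /derivable_mxP := dB i.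
  move=> f i [B sB ->].
  exists (fun y => pd i B y k l); first by exists (pd i B); [exact: smooth_on_pd|].
  move=> x Ux; rewrite pd_mxE// => k' l'.
  by have /derivable_mxP := (smooth_on_C1 sB Ux).2 i.
apply: (@smooth_coind _ _ _ U (fun B : 'rV[R]_n -> 'M[R]_(p, q) =>
  forall k l, smooth_on U (fun y => B y k l))) => // {sA A} B.
  move=> x sB Ux; split.
    by apply/continuous_mxP => k l; exact: (smooth_on_C1 (sB k l) Ux).1.
  by move=> i; apply/derivable_mxP => k l; exact: (smooth_on_C1 (sB k l) Ux).2.
move=> i sB; exists (fun y => \matrix_(k, l) pd i (fun z => B z k l) y).
  move=> k l; rewrite [X in smooth_on _ X](_ : _ = pd i (fun z => B z k l)).
    exact: smooth_on_pd.
  by apply/funext => y; rewrite mxE.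
move=> x Ux; apply/matrixP => k l; rewrite mxE pd_mxE// => k' l'.
exact: (smooth_on_C1 (sB k' l') Ux).2.
Qed.

Lemma smooth_det U (p : nat) (A : 'rV[R]_n -> 'M[R]_p) : open U ->
  (forall k l, smooth_on U (fun y => A y k l)) ->
  smooth_on U (fun y => \det (A y) : R).
Proof.
move=> oU sA; apply: smooth_sum => // s _; apply: smoothM => //.
  exact: smooth_cst.
exact: smooth_prod.
Qed.

(** By Cramer's rule the inverse is a polynomial in the entries divided by the
    determinant. *)
Lemma smooth_invmx U (p : nat) (A : 'rV[R]_n -> 'M[R]_p) : open U ->
  (forall k l, smooth_on U (fun y => A y k l)) ->
  (forall y, U y -> A y \in unitmx) ->
  forall k l, smooth_on U (fun y => invmx (A y) k l).
Proof.
move=> oU sA uA k l.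
apply: (@smooth_on_eq _ _ _ U
  (fun y => (\det (A y))^-1 * ((-1) ^+ (l + k) * \det (row' l (col' k (A y)))))).
- by [].
- by move=> y Uy; rewrite /invmx uA// !mxE /cofactor.
apply: smoothM => //.
  apply: smoothV => //; first exact: smooth_det.
  by move=> y /uA; rewrite unitmxE unitfE.
apply: smoothM => //; first exact: smooth_cst.
apply: smooth_det => // k' l'.
rewrite [X in smooth_on _ X](_ : _ = fun y => A y (lift l k') (lift k l'))//.
by apply/funext => y; rewrite !mxE.
Qed.

Definition smooth_cmx U (p q : nat) (A : 'rV[R]_n -> 'M[C]_(p, q)) :=
  forall k l, smooth_on U (fun y => complex.Re (A y k l)) /\
              smooth_on U (fun y => complex.Im (A y k l)).

(** The partial derivative of a matrix of complex functions, as a relation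
    between the map and its value: this packs differentiability with the
    value, and the rules below compose without side conditions. *)
Definition cmx_derive i x (p q : nat) (A : 'rV[R]_n -> 'M[C]_(p, q))
    (A' : 'M[C]_(p, q)) :=
  forall k l,
    is_derive x (delta_mx 0 i) (fun y => complex.Re (A y k l)) (complex.Re (A' k l)) /\
    is_derive x (delta_mx 0 i) (fun y => complex.Im (A y k l)) (complex.Im (A' k l)).

Definition cmx_pd i (p q : nat) (A : 'rV[R]_n -> 'M[C]_(p, q)) x : 'M[C]_(p, q) :=
  \matrix_(k, l) Complex (pd i (fun y => complex.Re (A y k l)) x)
                         (pd i (fun y => complex.Im (A y k l)) x).

Section Rules.
Variables (p q : nat).
Local Notation mxfun := ('rV[R]_n -> 'M[C]_(p, q)).

Lemma smooth_cmx_derive U (A : mxfun) i x : smooth_cmx U A -> U x ->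
  cmx_derive i x A (cmx_pd i A x).
Proof.
by move=> sA Ux k l; rewrite !mxE /=; have [sR sI] := sA k l; split; exact: is_derive_pd Ux.
Qed.

Lemma cmx_derive_val (A : mxfun) A' i x : cmx_derive i x A A' -> cmx_pd i A x = A'.
Proof.
move=> dA; apply/matrixP => k l; rewrite mxE; have [[_ dR] [_ dI]] := dA k l.
by rewrite /pd dR dI; case: (A' k l).
Qed.

Lemma cmx_derive_uniq (A : mxfun) A' A'' i x :
  cmx_derive i x A A' -> cmx_derive i x A A'' -> A' = A''.
Proof. by move=> /cmx_derive_val <- /cmx_derive_val <-. Qed.

Lemma cmx_derive_near U (A B : mxfun) A' i x : open U -> U x ->
  (forall y, U y -> A y = B y) -> cmx_derive i x A A' -> cmx_derive i x B A'.
Proof.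
move=> oU Ux e dA k l; have [dR dI] := dA k l.
by split; [move: dR|move: dI]; apply: near_eq_is_derive;
  apply: (near_eq_open oU Ux) => y Uy; rewrite e.
Qed.

Lemma cmx_derive_cst (A0 : 'M[C]_(p, q)) i x : cmx_derive i x (fun=> A0) 0.
Proof. by move=> k l; rewrite mxE; split; exact: is_derive_cst. Qed.

Lemma cmx_deriveD (A B : mxfun) A' B' i x : cmx_derive i x A A' -> cmx_derive i x B B' ->
  cmx_derive i x (fun y => A y + B y) (A' + B').
Proof.
move=> dA dB k l; have [dR dI] := dA k l; have [eR eI] := dB k l.
rewrite mxE ReD ImD; split.
  rewrite [X in is_derive _ _ X](_ : _ = fun y =>
    complex.Re (A y k l) + complex.Re (B y k l)); first exact: is_deriveD.
  by apply/funext => y; rewrite mxE ReD.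
rewrite [X in is_derive _ _ X](_ : _ = fun y =>
  complex.Im (A y k l) + complex.Im (B y k l)); first exact: is_deriveD.
by apply/funext => y; rewrite mxE ImD.
Qed.

Lemma cmx_deriveN (A : mxfun) A' i x : cmx_derive i x A A' ->
  cmx_derive i x (fun y => - A y) (- A').
Proof.
move=> dA k l; have [dR dI] := dA k l.
rewrite mxE ReN ImN; split.
  rewrite [X in is_derive _ _ X](_ : _ = fun y => - complex.Re (A y k l)).
    exact: is_deriveN.
  by apply/funext => y; rewrite mxE ReN.
rewrite [X in is_derive _ _ X](_ : _ = fun y => - complex.Im (A y k l)).
  exact: is_deriveN.
by apply/funext => y; rewrite mxE ImN.
Qed.

Lemma cmx_deriveB (A B : mxfun) A' B' i x : cmx_derive i x A A' -> cmx_derive i x B B' ->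
  cmx_derive i x (fun y => A y - B y) (A' - B').
Proof. by move=> dA /cmx_deriveN; exact: cmx_deriveD. Qed.

Lemma cmx_derive_tr (A : mxfun) A' i x : cmx_derive i x A A' ->
  cmx_derive i x (fun y => (A y)^T) A'^T.
Proof.
move=> dA k l; have [dR dI] := dA l k; rewrite mxE.
by split; [move: dR|move: dI]; congr is_derive; apply/funext => y; rewrite mxE.
Qed.

Lemma smooth_cmx_eq U (A B : mxfun) : open U ->
  (forall y, U y -> A y = B y) -> smooth_cmx U A -> smooth_cmx U B.
Proof.
move=> oU e sA k l; have [sR sI] := sA k l; split.
  by move: sR; apply: smooth_on_eq => // y Uy; rewrite e.
by move: sI; apply: smooth_on_eq => // y Uy; rewrite e.
Qed.

Lemma smooth_cmx_cst U (A0 : 'M[C]_(p, q)) : open U -> smooth_cmx U (fun=> A0).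
Proof. by move=> oU k l; split; exact: smooth_cst. Qed.

Lemma smooth_cmxD U (A B : mxfun) : open U -> smooth_cmx U A -> smooth_cmx U B ->
  smooth_cmx U (fun y => A y + B y).
Proof.
move=> oU sA sB k l; have [sR sI] := sA k l; have [tR tI] := sB k l; split.
  rewrite [X in smooth_on _ X](_ : _ = fun y =>
    complex.Re (A y k l) + complex.Re (B y k l)); first exact: smoothD.
  by apply/funext => y; rewrite mxE ReD.
rewrite [X in smooth_on _ X](_ : _ = fun y =>
  complex.Im (A y k l) + complex.Im (B y k l)); first exact: smoothD.
by apply/funext => y; rewrite mxE ImD.
Qed.

Lemma smooth_cmxN U (A : mxfun) : open U -> smooth_cmx U A -> smooth_cmx U (fun y => - A y).
Proof.
move=> oU sA k l; have [sR sI] := sA k l; split.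
  rewrite [X in smooth_on _ X](_ : _ = fun y => - complex.Re (A y k l)).
    exact: smoothN.
  by apply/funext => y; rewrite mxE ReN.
rewrite [X in smooth_on _ X](_ : _ = fun y => - complex.Im (A y k l)).
  exact: smoothN.
by apply/funext => y; rewrite mxE ImN.
Qed.

Lemma smooth_cmx_tr U (A : mxfun) : smooth_cmx U A -> smooth_cmx U (fun y => (A y)^T).
Proof.
move=> sA k l; have [sR sI] := sA l k.
by split; [move: sR|move: sI]; congr smooth_on; apply/funext => y; rewrite mxE.
Qed.

End Rules.

Lemma smooth_cmxM U p q r (A : 'rV[R]_n -> 'M[C]_(p, q))
    (B : 'rV[R]_n -> 'M[C]_(q, r)) : open U ->
  smooth_cmx U A -> smooth_cmx U B -> smooth_cmx U (fun y => A y *m B y).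
Proof.
move=> oU sA sB k l; split.
  rewrite [X in smooth_on _ X](_ : _ = fun y => \sum_t
     (complex.Re (A y k t) * complex.Re (B y t l) +
      (-1) * (complex.Im (A y k t) * complex.Im (B y t l)))); last first.
    by apply/funext => y; rewrite mxE Re_sum; under eq_bigr do rewrite ReM.
  apply: smooth_sum => // t _; have [sR sI] := sA k t; have [tR tI] := sB t l.
  apply: (smoothD oU); first exact: (smoothM oU sR tR).
  exact: (smoothM oU (smooth_cst (-1) oU) (smoothM oU sI tI)).
rewrite [X in smooth_on _ X](_ : _ = fun y => \sum_t
   (complex.Re (A y k t) * complex.Im (B y t l) +
    complex.Im (A y k t) * complex.Re (B y t l))); last first.
  by apply/funext => y; rewrite mxE Im_sum; under eq_bigr do rewrite ImM.
apply: smooth_sum => // t _; have [sR sI] := sA k t; have [tR tI] := sB t l.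
exact: (smoothD oU (smoothM oU sR tI) (smoothM oU sI tR)).
Qed.

Lemma cmx_deriveM p q r (A : 'rV[R]_n -> 'M[C]_(p, q))
    (B : 'rV[R]_n -> 'M[C]_(q, r)) A' B' i x :
  cmx_derive i x A A' -> cmx_derive i x B B' ->
  cmx_derive i x (fun y => A y *m B y) (A' *m B x + A x *m B').
Proof.
move=> dA dB k l; rewrite !mxE -big_split; split.
  rewrite [X in is_derive _ _ X](_ : _ = \sum_t (fun y =>
     (complex.Re (A y k t) * complex.Re (B y t l) +
      (-1) * (complex.Im (A y k t) * complex.Im (B y t l))))); last first.
    apply/funext => y; rewrite fct_sumE mxE Re_sum.
    by under eq_bigr do rewrite ReM.
  rewrite Re_sum; apply: is_derive_sum => t.
  have [dR dI] := dA k t; have [eR eI] := dB t l.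
  apply: (is_derive_eq (is_deriveD (is_deriveM dR eR)
    (is_deriveM (is_derive_cst (-1 : R) x _) (is_deriveM dI eI)))).
  by rewrite ReD !ReM /GRing.scale /=; ring.
rewrite [X in is_derive _ _ X](_ : _ = \sum_t (fun y =>
   (complex.Re (A y k t) * complex.Im (B y t l) +
    complex.Im (A y k t) * complex.Re (B y t l)))); last first.
  apply/funext => y; rewrite fct_sumE mxE Im_sum.
  by under eq_bigr do rewrite ImM.
rewrite Im_sum; apply: is_derive_sum => t.
have [dR dI] := dA k t; have [eR eI] := dB t l.
apply: (is_derive_eq (is_deriveD (is_deriveM dR eI) (is_deriveM dI eR))).
by rewrite ImD !ImM /GRing.scale /=; ring.
Qed.

End ComplexCalculus.

(** * The Sylvester equation *)

Section Sylvester.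
Variable R : realType.
Local Notation C := R[i].

Lemma unitmx_eigenvalue (K : fieldType) (m : nat) (A : 'M[K]_m) (a : K) :
  ~~ eigenvalue A a -> A - a%:M \in unitmx.
Proof.
by rewrite /eigenvalue /eigenspace negbK kermx_eq0 row_free_unit.
Qed.

(** If Y intertwines A with -B, it intertwines polynomials in A with the same
    polynomials in -B. *)
Lemma mul_horner_intertwine (K : fieldType) (m : nat) (A B Y : 'M[K]_m.+1)
  (s : seq K) : B *m Y + Y *m A = 0 ->
  (\prod_(z <- s) (- B - z%:M)) *m Y = Y *m \prod_(z <- s) (A - z%:M).
Proof.
move=> BYA; elim: s => [|z s IH]; first by rewrite !big_nil mul1mx mulmx1.
have e : (- B - z%:M) *m Y = Y *m (A - z%:M).
  rewrite mulmxBl mulmxBr mulNmx scalar_mxC; congr (_ - _).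
  by apply/esym/eqP; rewrite -addr_eq0 addrC BYA.
rewrite !big_cons -!mulmxE -mulmxA IH !mulmxA e.
by [].
Qed.

(** Apply the intertwining to the characteristic polynomial of P, in factored
    form. On the right Cayley-Hamilton gives zero; on the left each factor -
    P^T - z is invertible because - z is not an eigenvalue of P. Hence Y = 0.
    *)
Lemma spectrum_sylvester_inj (m : nat) (P : 'M[R]_m) (Yc : 'M[C]_m) :
  spectrum_condition P ->
  (map_mx (real_complex R) P)^T *m Yc + Yc *m map_mx (real_complex R) P = 0 ->
  Yc = 0.
Proof.
case: m P Yc => [|m] P Yc; first by move=> _ _; rewrite [Yc]thinmx0.
set Pc := map_mx _ P => sP YPc.
have [s es] := closed_field_poly_normal (char_poly Pc).
rewrite (monicP (char_poly_monic Pc)) scale1r in es.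
have Y0 : Yc *m \prod_(z <- s) (Pc - z%:M) = 0.
  have := Cayley_Hamilton Pc; rewrite es rmorph_prod /=.
  under eq_bigr do rewrite rmorphB /= horner_mx_X horner_mx_C.
  by move=> ->; rewrite mulmx0.
have uB : \prod_(z <- s) (- Pc^T - z%:M) \in unitmx.
  rewrite big_seq; apply: (big_ind (fun A : 'M[C]_m.+1 => A \in unitmx)).
  - exact: unitmx1.
  - by move=> A B uA uB; rewrite unitmx_mul uA.
  - move=> z zs; have /sP /unitmx_eigenvalue uz : eigenvalue Pc z.
      by rewrite eigenvalue_root_char es root_prod_XsubC.
    have -> : - Pc^T - z%:M = - 1 *: (Pc - (- z)%:M)^T.
      by rewrite linearB /= tr_scalar_mx raddfN /= opprK scalerDr !scaleN1r.
    by rewrite unitmxZ ?unitrN1 ?unitmx_tr ?uz.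
have := mul_horner_intertwine s YPc; rewrite Y0 => /(congr1 (mulmx (invmx
  (\prod_(z <- s) (- Pc^T - z%:M))))).
by rewrite mulKmx// mulmx0.
Qed.

Lemma sylvester_uniq_cplx (m : nat) (P : 'M[R]_m) (Y Z : 'M[C]_m) :
  spectrum_condition P ->
  let Pc := map_mx (real_complex R) P in
  Pc^T *m Y + Y *m Pc = Pc^T *m Z + Z *m Pc -> Y = Z.
Proof.
move=> sP /= e; apply/eqP; rewrite -subr_eq0; apply/eqP.
apply: (spectrum_sylvester_inj sP); rewrite mulmxBl mulmxBr.
by rewrite addrACA -opprD e subrr.
Qed.

Lemma sylvester_uniq (m : nat) (P Y Z : 'M[R]_m) : spectrum_condition P ->
  P^T *m Y + Y *m P = P^T *m Z + Z *m P -> Y = Z.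
Proof.
move=> sP e; apply: (@map_mx_inj _ _ (real_complex R)).
apply: (sylvester_uniq_cplx sP) => /=.
by rewrite !map_trmx -!map_mxM -!map_mxD e.
Qed.

Lemma eigenvalue_conj (m : nat) (P : 'M[R]_m) (l : C) :
  eigenvalue (map_mx (real_complex R) P) l ->
  eigenvalue (map_mx (real_complex R) P) (conjc l).
Proof.
move=> /eigenvalueP[u ul u0]; apply/eigenvalueP.
exists (map_mx conjc u); last by rewrite map_mx_eq0.
have := congr1 (map_mx conjc) ul; rewrite map_mxM map_mxZ.
rewrite -[map_mx conjc (map_mx _ P)]map_mx_comp => <-; congr (_ *m _).
by apply/matrixP => a b; rewrite !mxE /= oppr0.
Qed.

(** The number 0 is its own opposite, so the spectral condition excludes it
    from the spectrum. *)
Lemma spectrum_unit (m : nat) (P : 'M[R]_m) :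
  spectrum_condition P -> P \in unitmx.
Proof.
move=> sP; rewrite -(map_unitmx (real_complex R)).
have /unitmx_eigenvalue : ~~ eigenvalue (map_mx (real_complex R) P) 0.
  by apply/negP => e0; have := sP 0 e0; rewrite oppr0 e0.
by rewrite raddf0 subr0.
Qed.

(** The spectrum of a real matrix is stable under conjugation, which exchanges
    the opposite numbers i and -i: neither is an eigenvalue, and P^2 + 1 = (P
    - i)(P + i) is invertible. *)
Lemma spectrum_unit_sqrD1 (m : nat) (P : 'M[R]_m) :
  spectrum_condition P -> P *m P + 1%:M \in unitmx.
Proof.
move=> sP; pose Pc := map_mx (real_complex R) P.
have ni : ~~ eigenvalue Pc 'i%C.
  apply/negP => ei; have /negP := sP _ ei; apply.
  rewrite (_ : - 'i%C = conjc 'i%C); first exact: eigenvalue_conj ei.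
  by apply: complex_eq; rewrite /= ?oppr0.
have nNi : ~~ eigenvalue Pc (- 'i%C).
  apply/negP => e; move/negP: ni; apply.
  rewrite (_ : 'i%C = conjc (- 'i%C)); first exact: eigenvalue_conj e.
  by apply: complex_eq; rewrite /= ?oppr0 ?opprK.
rewrite -(map_unitmx (real_complex R)) map_mxD map_mxM map_mx1.
rewrite (_ : _ + _ = (Pc - 'i%C%:M) *m (Pc - (- 'i%C)%:M)); last first.
  rewrite raddfN /= opprK mulmxBl !mulmxDr scalar_mxC opprD addrA addrK.
  rewrite -scalar_mxM -expr2 sqr_i; congr (_ + _).
  by rewrite raddfN /= opprK.
by rewrite unitmx_mul (unitmx_eigenvalue ni) (unitmx_eigenvalue nNi).
Qed.

(** As the Sylvester operator is injective, Y is obtained from the right-hand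
    side by a constant matrix, hence is as smooth as it. *)
Lemma smooth_sylvester (n m : nat) (U : set 'rV[R]_n) (P : 'M[R]_m)
  (Y D : 'rV[R]_n -> 'M[R]_m) : open U -> spectrum_condition P ->
  (forall k l, smooth_on U (fun y => D y k l)) ->
  (forall y, U y -> P^T *m Y y + Y y *m P = D y) ->
  forall k l, smooth_on U (fun y => Y y k l).
Proof.
move=> oU sP sD eY k l.
(* The matrix of the Sylvester operator on vectorised matrices. *)
pose L := lin_mulmx P^T + lin_mulmxr P.
have LE (Z : 'M[R]_m) : mxvec Z *m L = mxvec (P^T *m Z + Z *m P).
  by rewrite mulmxDr !mul_vec_lin -raddfD.
have uL : L \in unitmx.
  rewrite -row_free_unit; apply: inj_row_free => w.
  rewrite -[w]vec_mxK LE => /(canRL mxvecK); rewrite linear0 => w0.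
  rewrite (_ : vec_mx w = 0) ?linear0//; apply: (sylvester_uniq sP).
  by rewrite w0 mulmx0 mul0mx addr0.
apply: (@smooth_on_eq _ _ _ U
  (fun y => \sum_t mxvec (D y) 0 t * invmx L t (mxvec_index k l))) => //.
  by move=> y Uy; rewrite -(eY y Uy) -LE -(mxvecE (Y y)) -{2}(mulmxK uL (mxvec (Y y))) [RHS]mxE.
apply: smooth_sum => // t _; case/mxvec_indexP: t => a b.
apply: smoothM => //; last exact: smooth_cst.
by move: (sD a b); congr smooth_on; apply/funext => y; rewrite mxvecE.
Qed.

End Sylvester.

(** * Algebra of the dressing transformation *)

Lemma mxDE (K : nmodType) p q (A B : 'M[K]_(p, q)) i j :
  (A + B) i j = A i j + B i j.
Proof. by rewrite mxE. Qed.
Lemma mxNE (K : zmodType) p q (A : 'M[K]_(p, q)) i j : (- A) i j = - A i j.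
Proof. by rewrite mxE. Qed.
Lemma mxZE (K : comNzRingType) p q (a : K) (A : 'M[K]_(p, q)) i j :
  (a *: A) i j = a * A i j.
Proof. by rewrite mxE. Qed.
Lemma mx0E (K : nmodType) p q i j : (0 : 'M[K]_(p, q)) i j = 0.
Proof. by rewrite mxE. Qed.

Lemma mulZmx (K : comNzRingType) p q r (a : K) (A : 'M[K]_(p, q))
  (B : 'M[K]_(q, r)) : (a *: A) *m B = a *: (A *m B).
Proof. by rewrite scalemxAl. Qed.
Lemma mulmxZ (K : comNzRingType) p q r (a : K) (A : 'M[K]_(p, q))
  (B : 'M[K]_(q, r)) : A *m (a *: B) = a *: (A *m B).
Proof. by rewrite scalemxAr. Qed.

(** Identities between noncommutative polynomials in rectangular matrices:
    both sides are expanded into monomials, which are then compared entrywise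
    as elements of a commutative ring. *)
Ltac mx_expand := rewrite ?(mulmxDl, mulmxDr, mulNmx, mulmxN, mulmx0, mul0mx,
  mulmx1, mul1mx, mulmxA, mulZmx, mulmxZ, opprD, opprK, scalerDr, scalerN).
Ltac mx_ring := apply/matrixP => ? ?; rewrite ?(mxDE, mxNE, mxZE, mx0E); ring.

Section Dressing.
Variables (K : comNzRingType) (p m q : nat) (ii : K).
Variables (Phi : 'M[K]_(p, m)) (Psi : 'M[K]_(p, q)) (J E A : 'M[K]_p).
Variables (Q M N L Kt : 'M[K]_m).
Hypothesis AJ : A^T *m J = - (J *m A).
Hypothesis JE : J *m E = E.
Hypothesis EJ : E *m J = E.
Hypothesis trE : E^T = E.
Hypothesis mul_M_N : M *m N = 1%:M.
Hypothesis mul_N_M : N *m M = 1%:M.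
Hypothesis N_sylvester_Q : N *m Q + Q^T *m N = Phi^T *m J *m Phi.
Hypothesis LE : L = M *m Kt.
Hypothesis KtE : (Q^T - ii%:M) *m Kt = 1%:M.
Hypothesis EKt : Kt *m (Q^T - ii%:M) = 1%:M.

Let D := Phi^T *m J *m Phi.
Let dPhi := A *m Phi - E *m Phi *m Q.
Let dPsi := A *m Psi + ii *: (E *m Psi).
Let S := Phi *m M *m Phi^T.

(** The contributions of A cancel as A is skew for J; only the part of d Phi
    that carries Q remains. *)
Lemma dressing_gram_derive :
  (dPhi^T *m J) *m Phi + (Phi^T *m J) *m dPhi =
  - (Q^T *m (Phi^T *m E *m Phi) + Phi^T *m E *m Phi *m Q).
Proof.
have e1 : Phi^T *m A^T *m J *m Phi = - (Phi^T *m J *m A *m Phi).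
  by rewrite -(mulmxA _ A^T) AJ; mx_expand.
have e2 : Q^T *m Phi^T *m E *m J *m Phi = Q^T *m Phi^T *m E *m Phi.
  by rewrite -(mulmxA _ E) EJ.
have e3 : Phi^T *m J *m E *m Phi *m Q = Phi^T *m E *m Phi *m Q.
  by rewrite -(mulmxA _ J) JE.
rewrite /dPhi linearB /= !trmx_mul trE.
mx_expand; rewrite e1 e2 e3; mx_ring.
Qed.

(** The Sylvester equation of N, written for its inverse M. *)
Lemma dressing_quad : M *m D *m M = Q *m M + M *m Q^T.
Proof.
rewrite /D -N_sylvester_Q mulmxDr mulmxDl !mulmxA mul_M_N mul1mx.
by rewrite -(mulmxA _ N M) mul_N_M mulmx1.
Qed.

(** The rule that moves Q across the resolvent in L; the imaginary unit that
    it produces becomes the term ii E of the new system. *)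
Lemma dressing_QL : Q *m L = M *m D *m L - M - ii *: L.
Proof.
have e : M *m Q^T *m Kt = M + ii *: L.
  have -> : Q^T = (Q^T - ii%:M) + ii%:M by rewrite subrK.
  rewrite mulmxDr mulmxDl -mulmxA KtE mulmx1 mul_mx_scalar -scalemxAl LE.
  by [].
rewrite {2}LE [in RHS]mulmxA dressing_quad mulmxDl e LE mulmxA; mx_ring.
Qed.

Lemma dressing_LN : L *m (Q^T - ii%:M) = M.
Proof. by rewrite LE -mulmxA EKt mulmx1. Qed.

Let G := Phi^T *m J *m Psi.
Let dG := - ((Q^T - ii%:M) *m Phi^T *m E *m Psi).
Let Psit := Psi - Phi *m L *m G.

(** The connection A again drops out, so the derivative of Phi^T J Psi
    involves only the i-th leg. *)
Lemma dressing_potential_derive :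
  (dPhi^T *m J) *m Psi + (Phi^T *m J) *m dPsi = dG.
Proof.
have e1 : Phi^T *m A^T *m J *m Psi = - (Phi^T *m J *m A *m Psi).
  by rewrite -(mulmxA _ A^T) AJ; mx_expand.
have e2 : Q^T *m Phi^T *m E *m J *m Psi = Q^T *m Phi^T *m E *m Psi.
  by rewrite -(mulmxA _ E) EJ.
have e3 : Phi^T *m J *m E *m Psi = Phi^T *m E *m Psi.
  by rewrite -(mulmxA _ J) JE.
rewrite /dPhi /dPsi /dG linearB /= !trmx_mul trE.
mx_expand; rewrite mul_scalar_mx; mx_expand; rewrite e1 e2 e3; mx_ring.
Qed.

(** The transformed frame satisfies a system of the original shape: the new
    terms assemble into the correction S E - E S J of the connection, acting
    on the transformed frame itself. *)
Lemma dressing_derive :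
  dPsi - ((dPhi *m L + Phi *m (M *m Phi^T *m E *m Phi *m L)) *m G
          + Phi *m L *m dG)
  = (A + S *m E - E *m S *m J) *m Psit + ii *: (E *m Psit).
Proof.
have e0 : Phi *m L *m dG = - (S *m E *m Psi).
  rewrite /dG /S mulmxN; congr (- _).
  rewrite -!mulmxA; congr (_ *m _); rewrite !mulmxA dressing_LN.
  by [].
have e1 : E *m Phi *m Q *m L *m G
    = E *m Phi *m M *m D *m L *m G - E *m S *m J *m Psi - ii *: (E *m Phi *m L *m G).
  have -> : E *m Phi *m Q *m L *m G = E *m Phi *m (Q *m L) *m G by rewrite !mulmxA.
  have -> : E *m S *m J *m Psi = E *m Phi *m M *m G by rewrite /S /G !mulmxA.
  by rewrite dressing_QL; mx_expand.
have e2 : E *m S *m J *m Phi *m L *m G = E *m Phi *m M *m D *m L *m G.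
  by rewrite /S /D; mx_expand.
have e3 : Phi *m M *m Phi^T *m E *m Phi *m L *m G = S *m E *m Phi *m L *m G.
  by [].
(* The abbreviations become opaque, so that the expansion stops at S, G and D.
   *)
rewrite e0 /dPhi /dPsi /Psit; clear e0; clearbody dPhi dPsi Psit dG S G D.
by mx_expand; rewrite e1 e2 e3; mx_ring.
Qed.

(** The derivative of S = Phi M Phi^T, which governs the corrections to v and
    h. *)
Lemma dressing_S_derive : M^T = M ->
  (dPhi *m M + Phi *m (M *m Phi^T *m E *m Phi *m M)) *m Phi^T
    + Phi *m M *m dPhi^T
  = A *m S + S *m A^T - E *m (Phi *m Q *m M *m Phi^T)
    - (Phi *m Q *m M *m Phi^T)^T *m E + S *m E *m S.
Proof.
move=> M_sym; rewrite /dPhi /S linearB /= !trmx_mul M_sym trE !trmxK.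
mx_expand; mx_ring.
Qed.

(** This turns the terms with Q, once summed over all the partial derivatives,
    into a quadratic expression in S. *)
Lemma dressing_S_quad : M^T = M ->
  Phi *m Q *m M *m Phi^T + (Phi *m Q *m M *m Phi^T)^T = S *m J *m S.
Proof.
move=> M_sym; rewrite !trmx_mul M_sym trmxK /S.
have -> : Phi *m M *m Phi^T *m J *m (Phi *m M *m Phi^T)
   = Phi *m (M *m D *m M) *m Phi^T by rewrite /D; mx_expand.
by rewrite dressing_quad; mx_expand.
Qed.

(** Psis and Ls stand for the conjugate transposes of Psi and L. The relation
    L D Ls = L + Ls, a consequence of the Sylvester equation, makes the
    corrections to the Gram matrix cancel. *)
Lemma dressing_gram (Hm : 'M[K]_q) (Psis : 'M[K]_(q, p)) (Ls : 'M[K]_m)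
    (Ji : 'M[K]_p) :
  J *m Ji = 1%:M -> Ji *m J = 1%:M -> Psi *m Hm *m Psis = Ji ->
  (Q + ii%:M) *m Ls = M ->
  Psit *m Hm *m (Psis - Psis *m J *m Phi *m Ls *m Phi^T) = Ji.
Proof.
move=> JJi JiJ gram QLs.
have LDL : L *m D *m Ls = L + Ls.
  have -> : D = N *m (Q + ii%:M) + (Q^T - ii%:M) *m N.
    rewrite /D -N_sylvester_Q mulmxDr mulmxBl mul_scalar_mx mul_mx_scalar; mx_ring.
  rewrite mulmxDr mulmxDl -!mulmxA QLs mul_N_M mulmx1 !mulmxA dressing_LN mul_M_N mul1mx.
  by [].
have eG : G *m Hm *m Psis = Phi^T.
  have -> : G *m Hm *m Psis = Phi^T *m J *m (Psi *m Hm *m Psis).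
    by rewrite /G !mulmxA.
  by rewrite gram -mulmxA JJi mulmx1.
have e : Psit *m Hm *m Psis = Ji - Phi *m L *m Phi^T.
  rewrite /Psit 2!mulmxBl gram; congr (_ - _).
  by rewrite -2!(mulmxA (Phi *m L)) eG.
rewrite mulmxBr !(mulmxA (Psit *m Hm)).
rewrite e 4!mulmxBl JiJ mul1mx.
have -> : Phi *m L *m Phi^T *m J *m Phi *m Ls *m Phi^T
        = Phi *m (L *m D *m Ls) *m Phi^T by rewrite /D !mulmxA.
by rewrite LDL mulmxDr mulmxDl; mx_ring.
Qed.

End Dressing.

(** * Connection matrices in principal coordinates *)

Section Connection.
Variables (K : comNzRingType) (n : nat) (c : K).
Local Notation o := (ord0 : 'I_n.+1).
Local Notation l := (lift (ord0 : 'I_n.+1)).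

(** Row 0 is x, the position; the row of index j + 1 is y j, the j-th tangent
    leg. *)
Definition row_stack (T : Type) (p q : nat) (x : 'rV[T]_q) (y : 'I_p -> 'rV[T]_q) :
    'M[T]_(p.+1, q) :=
  \matrix_(a, b) (if unlift ord0 a is Some j then y j 0 b else x 0 b).

Lemma row_stack0 (T : Type) (p q : nat) x y b : @row_stack T p q x y ord0 b = x 0 b.
Proof. by rewrite mxE unlift_none. Qed.

Lemma row_stackS (T : Type) (p q : nat) x y j b :
  @row_stack T p q x y (lift ord0 j) b = y j 0 b.
Proof. by rewrite mxE liftK. Qed.

Lemma row_stackP (T : Type) (p q : nat) (X Y : 'M[T]_(p.+1, q)) :
  (forall b, X ord0 b = Y ord0 b) ->
  (forall j b, X (lift ord0 j) b = Y (lift ord0 j) b) -> X = Y.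
Proof.
by move=> e0 eS; apply/matrixP => a b; case: (unliftP ord0 a) => [j|] ->.
Qed.

(** The matrix A_i of the system satisfied by the frame (F, e_1, ..., e_n):
    d_i F = v_i e_i, d_i e_j = h_ji e_i for j different from i, and d_i e_i =
    - c v_i F - sum_k h_ki e_k, up to the rotated leg i e_i that the system
    adds separately. *)
Definition frame_conn (v : 'I_n -> K) (h : 'I_n -> 'I_n -> K) (i : 'I_n) : 'M[K]_n.+1 :=
  \matrix_(a, b)
   match unlift o a, unlift o b with
   | None, None => 0
   | None, Some k => if k == i then v i else 0
   | Some j, None => if j == i then - (c * v i) else 0
   | Some j, Some k => if j == i then (if k == i then 0 else - h k i)
                       else if k == i then h j i else 0
   end.

(** The matrix diag(c, 1, ..., 1). It is used with c, with 1/c for the Gram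
    matrix of a frame, and with eps for the ambient metric. *)
Definition head_diag : 'M[K]_n.+1 :=
  \matrix_(a, b) (if a == b then if a == o then c else 1 else 0).

Definition leg_proj (i : 'I_n) : 'M[K]_n.+1 := delta_mx (l i) (l i).

Lemma sum_ord0_lift (F : 'I_n.+1 -> K) :
  \sum_a F a = F o + \sum_k F (l k).
Proof. exact: big_ord_recl. Qed.

Lemma leg_proj_mul q (X : 'M[K]_(n.+1, q)) i a b :
  (leg_proj i *m X) a b = if a == l i then X (l i) b else 0.
Proof.
rewrite mxE (bigD1 (l i))//= big1 ?addr0; last first.
  by move=> k ki; rewrite !mxE (negPf ki) andbF mul0r.
by rewrite !mxE eqxx andbT; case: eqP; rewrite ?mul1r ?mul0r.
Qed.

Lemma mul_leg_proj q (X : 'M[K]_(q, n.+1)) i a b :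
  (X *m leg_proj i) a b = if b == l i then X a (l i) else 0.
Proof.
rewrite mxE (bigD1 (l i))//= big1 ?addr0; last first.
  by move=> k ki; rewrite !mxE (negPf ki) mulr0.
by rewrite !mxE eqxx /=; case: eqP; rewrite ?mulr1 ?mulr0.
Qed.

Lemma head_diag_mul q (X : 'M[K]_(n.+1, q)) a b :
  (head_diag *m X) a b = (if a == o then c else 1) * X a b.
Proof.
rewrite mxE (bigD1 a)//= big1 ?addr0; last first.
  by move=> k ka; rewrite !mxE eq_sym (negPf ka) mul0r.
by rewrite !mxE eqxx.
Qed.

Lemma mul_head_diag q (X : 'M[K]_(q, n.+1)) a b :
  (X *m head_diag) a b = X a b * (if b == o then c else 1).
Proof.
rewrite mxE (bigD1 b)//= big1 ?addr0; last first.
  by move=> k kb; rewrite !mxE (negPf kb) mulr0.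
by rewrite !mxE eqxx.
Qed.

Lemma tr_head_diag : head_diag^T = head_diag.
Proof.
by apply/matrixP => a b; rewrite !mxE eq_sym; case: eqP => [->|].
Qed.

Lemma lift0_neq j : (l j == o) = false.
Proof. by []. Qed.

Lemma neq_lift0 j : (o == l j) = false.
Proof. by []. Qed.

Lemma lift0_eq j k : (l j == l k) = (j == k).
Proof. by rewrite (inj_eq lift_inj). Qed.

Lemma head_diag_leg_proj i : head_diag *m leg_proj i = leg_proj i.
Proof.
apply/matrixP => a b; rewrite head_diag_mul mxE.
by case: (a =P l i) => [->|_]; rewrite /= ?mul1r ?mulr0.
Qed.

Lemma leg_proj_head_diag i : leg_proj i *m head_diag = leg_proj i.
Proof.
apply/matrixP => a b; rewrite mul_head_diag mxE.
by case: (b =P l i) => [->|_]; rewrite /= ?mulr1 ?andbF ?mul0r.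
Qed.

Lemma tr_leg_proj i : (leg_proj i)^T = leg_proj i.
Proof. exact: trmx_delta. Qed.

Lemma frame_conn_skew v h i : (frame_conn v h i)^T *m head_diag = - (head_diag *m frame_conn v h i).
Proof.
apply/matrixP => a b; rewrite mul_head_diag mxNE head_diag_mul !mxE.
case: (unliftP o a) => [j|] ->; case: (unliftP o b) => [k|] -> //=;
  rewrite ?unlift_none ?liftK; repeat case: eqP => //= _; ring.
Qed.

Lemma frame_conn_mul0 q v h i (X : 'M[K]_(n.+1, q)) b :
  (frame_conn v h i *m X) o b = v i * X (l i) b.
Proof.
rewrite mxE sum_ord0_lift !mxE unlift_none mul0r add0r (bigD1 i)//= big1.
  by rewrite addr0 mxE unlift_none liftK eqxx.
by move=> k ki; rewrite mxE unlift_none liftK (negPf ki) mul0r.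
Qed.

Lemma frame_conn_mul_neq q v h i j (X : 'M[K]_(n.+1, q)) b : j != i ->
  (frame_conn v h i *m X) (l j) b = h j i * X (l i) b.
Proof.
move=> ji; rewrite mxE sum_ord0_lift !mxE unlift_none liftK (negPf ji).
rewrite mul0r add0r (bigD1 i)//= big1.
  by rewrite addr0 mxE !liftK (negPf ji) eqxx.
by move=> k ki; rewrite mxE !liftK (negPf ji) (negPf ki) mul0r.
Qed.

Lemma frame_conn_mul_eq q v h i (X : 'M[K]_(n.+1, q)) b :
  (frame_conn v h i *m X) (l i) b =
  - (c * v i * X o b) - \sum_(k < n | k != i) h k i * X (l k) b.
Proof.
rewrite mxE sum_ord0_lift !mxE unlift_none liftK eqxx mulNr; congr (_ + _).
rewrite (bigD1 i)//= mxE !liftK eqxx mul0r add0r -sumrN.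
by apply: eq_bigr => k ki; rewrite mxE !liftK eqxx (negPf ki) mulNr.
Qed.

(** The correction S E - E S J only touches the row and the column of the i-th
    leg, where it adds the entries of S to v and h with the signs of the
    connection matrix. *)
Lemma frame_conn_dress v h i (S : 'M[K]_n.+1) : S^T = S ->
  frame_conn v h i + S *m leg_proj i - leg_proj i *m S *m head_diag
  = frame_conn (fun k => v k + S o (l k)) (fun j k => h j k + S (l j) (l k)) i.
Proof.
move=> S_sym; have Sym a b : S a b = S b a by rewrite -{1}S_sym mxE.
apply/matrixP => a b; rewrite 2!mxDE mxNE mul_leg_proj mul_head_diag leg_proj_mul !mxE.
case: (unliftP o a) => [j|] ->; case: (unliftP o b) => [k|] -> //=;
  rewrite ?unlift_none ?liftK ?lift0_neq ?neq_lift0 ?lift0_eq ?eqxx /=.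
- by have [ji|ji] := eqVneq j i; have [ki|ki] := eqVneq k i; rewrite ?ji ?ki
    ?(Sym (l i)); ring.
- by have [ji|ji] := eqVneq j i; rewrite ?ji ?(Sym (l i)); ring.
- by have [ki|ki] := eqVneq k i; ring.
- by ring.
Qed.

Lemma frame_conn_S0 v h i j : frame_conn v h i (l j) o = if j == i then - (c * v i) else 0.
Proof. by rewrite mxE liftK unlift_none. Qed.

(** When h is symmetric, the off-diagonal terms cancel in the sum over all
    directions: this is the reason why the operator d_1 + ... + d_n occurs in
    the system. *)
Lemma sum_frame_conn_mul q v h j (X : 'M[K]_(n.+1, q)) b :
  (forall k, k != j -> h k j = h j k) ->
  \sum_i (frame_conn v h i *m X) (l j) b = - (c * v j * X o b).
Proof.
move=> sh; rewrite (bigD1 j)//= frame_conn_mul_eq.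
rewrite [Z in _ + Z](eq_bigr (fun k => h k j * X (l k) b)); first by rewrite subrK.
by move=> k kj; rewrite frame_conn_mul_neq 1?eq_sym// sh.
Qed.

End Connection.

Lemma map_frame_conn (K K' : comNzRingType) (f : {rmorphism K -> K'}) n (c : K)
    (v : 'I_n -> K) (h : 'I_n -> 'I_n -> K) i :
  map_mx f (frame_conn c v h i) = frame_conn (f c) (fun k => f (v k)) (fun j k => f (h j k)) i.
Proof.
apply/matrixP => a b; rewrite !mxE.
by case: (unlift ord0 a) => [j|]; case: (unlift ord0 b) => [k|];
  repeat case: ifP => _; rewrite ?rmorphN ?rmorphM ?rmorph0.
Qed.

(** * The pseudo-Hermitian form and derivatives of complex maps *)

Section Geps.
Variables (R : realType) (n : nat) (eps : R).
Local Notation C := R[i].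
Implicit Types z w : 'rV[C]_n.+1.

Definition conjmx (p q : nat) (A : 'M[C]_(p, q)) : 'M[C]_(q, p) :=
  (map_mx conjc A)^T.

Lemma conjmxM p q r (A : 'M[C]_(p, q)) (B : 'M[C]_(q, r)) :
  conjmx (A *m B) = conjmx B *m conjmx A.
Proof. by rewrite /conjmx map_mxM trmx_mul. Qed.

Lemma conjmxB p q (A B : 'M[C]_(p, q)) : conjmx (A - B) = conjmx A - conjmx B.
Proof. by rewrite /conjmx map_mxB linearB. Qed.

Lemma conjmx_real p q (A : 'M[R]_(p, q)) :
  conjmx (map_mx (real_complex R) A) = map_mx (real_complex R) A^T.
Proof. by apply/matrixP => i j; rewrite !mxE /= oppr0. Qed.

(** The pseudo-Hermitian form of which geps is the real part; its imaginary
    part records horizontality. *)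
Definition herm z w : C := (z *m head_diag n (eps%:C)%C *m conjmx w) 0 0.

Lemma gepsE z w : geps eps z w = complex.Re (herm z w).
Proof.
rewrite /geps /herm mxE; congr complex.Re.
rewrite [RHS](bigD1 ord0)//=; congr (_ + _).
  by rewrite mul_head_diag !mxE eqxx mulrCA mulrA.
by apply: eq_bigr => j /negPf j0; rewrite mul_head_diag !mxE j0 mulr1.
Qed.

Lemma herm_row p q (A : 'M[C]_(p, n.+1)) (B : 'M[C]_(q, n.+1)) a b :
  (A *m head_diag n (eps%:C)%C *m conjmx B) a b = herm (row a A) (row b B).
Proof. by rewrite /herm !mxE; apply: eq_bigr => k _; rewrite !mul_head_diag !mxE. Qed.

Lemma hermD1 z z' w : herm (z + z') w = herm z w + herm z' w.
Proof. by rewrite /herm !mulmxDl mxE. Qed.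
Lemma hermZ1 a z w : herm (a *: z) w = a * herm z w.
Proof. by rewrite /herm -!scalemxAl mxE. Qed.
Lemma hermC z w : herm z w = conjc (herm w z).
Proof.
rewrite /herm !mxE rmorph_sum /=; apply: eq_bigr => k _.
rewrite !mul_head_diag !mxE !rmorphM /= conjcK mulrC.
have -> : ((if k == ord0 then (eps%:C)%C else 1) : C)^*%C
   = (if k == ord0 then (eps%:C)%C else 1) by case: ifP => _; rewrite ?conjc_real ?conjc1.
by rewrite [Z in _ * Z = _]mulrC mulrA.
Qed.

Lemma gepsC z w : geps eps z w = geps eps w z.
Proof. by rewrite !gepsE hermC; case: (herm _ _). Qed.
Lemma gepsD1 z z' w : geps eps (z + z') w = geps eps z w + geps eps z' w.
Proof. by rewrite !gepsE hermD1 ReD. Qed.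
Lemma gepsD2 z w w' : geps eps z (w + w') = geps eps z w + geps eps z w'.
Proof. by rewrite gepsC gepsD1 !(gepsC z). Qed.
Lemma gepsZ1 (a : R) z w : geps eps ((a%:C)%C *: z) w = a * geps eps z w.
Proof. by rewrite !gepsE hermZ1 ReM /= mul0r mulr0 addr0. Qed.
Lemma gepsZ2 (a : R) z w : geps eps z ((a%:C)%C *: w) = a * geps eps z w.
Proof. by rewrite gepsC gepsZ1 gepsC. Qed.
Lemma geps0l w : geps eps 0 w = 0.
Proof. by rewrite -(scale0r (0 : 'rV[C]_n.+1)) (gepsZ1 0) mul0r. Qed.
Lemma geps0r z : geps eps z 0 = 0.
Proof. by rewrite gepsC geps0l. Qed.
Lemma gepsN1 z w : geps eps (- z) w = - geps eps z w.
Proof. by apply/eqP; rewrite -addr_eq0 -gepsD1 addNr geps0l. Qed.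
Lemma gepsN2 z w : geps eps z (- w) = - geps eps z w.
Proof. by rewrite gepsC gepsN1 gepsC. Qed.
Lemma geps_sum1 (I : Type) (r : seq I) (Pr : pred I) (f : I -> 'rV[C]_n.+1) w :
  geps eps (\sum_(k <- r | Pr k) f k) w = \sum_(k <- r | Pr k) geps eps (f k) w.
Proof.
apply: (big_morph (fun z => geps eps z w)); last exact: geps0l.
by move=> z z'; exact: gepsD1.
Qed.
Lemma geps_sum2 (I : Type) (r : seq I) (Pr : pred I) (f : I -> 'rV[C]_n.+1) z :
  geps eps z (\sum_(k <- r | Pr k) f k) = \sum_(k <- r | Pr k) geps eps z (f k).
Proof. by rewrite gepsC geps_sum1; apply: eq_bigr => k _; rewrite gepsC. Qed.

Lemma geps_J1 z w : geps eps (Jmul z) w = - complex.Im (herm z w).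
Proof. by rewrite gepsE hermZ1 mulrC ReiNIm. Qed.
Lemma geps_JJ z w : geps eps (Jmul z) (Jmul w) = geps eps z w.
Proof.
rewrite geps_J1 hermC hermZ1 gepsE (hermC z w); case: (herm w z) => a b /=.
by rewrite mul0r mul1r add0r opprK.
Qed.
Lemma geps_J2 z w : geps eps z (Jmul w) = - geps eps (Jmul z) w.
Proof.
rewrite gepsC !geps_J1 (hermC z w); case: (herm w z) => a b /=.
by rewrite opprK.
Qed.
Lemma JmulJ z : Jmul (Jmul z) = - z.
Proof. by rewrite /Jmul scalerA -expr2 sqr_i scaleN1r. Qed.
Lemma geps_Jzz z : geps eps (Jmul z) z = 0.
Proof.
apply/eqP; rewrite -[_ == 0](mulrn_eq0 _ 2) mulr2n.
by rewrite {2}gepsC geps_J2 subrr.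
Qed.
Lemma herm_parts z w : herm z w = Complex (geps eps z w) (- geps eps (Jmul z) w).
Proof. by rewrite geps_J1 opprK gepsE; case: (herm z w). Qed.

Lemma JmulD z w : Jmul (z + w) = Jmul z + Jmul w.
Proof. by rewrite /Jmul scalerDr. Qed.
Lemma JmulN z : Jmul (- z) = - Jmul z.
Proof. by rewrite /Jmul scalerN. Qed.
Lemma JmulZ (a : C) z : Jmul (a *: z) = a *: Jmul z.
Proof. by rewrite /Jmul !scalerA mulrC. Qed.
Lemma Jmul_sum (I : Type) (r : seq I) (Pr : pred I) (f : I -> 'rV[C]_n.+1) :
  Jmul (\sum_(k <- r | Pr k) f k) = \sum_(k <- r | Pr k) Jmul (f k).
Proof. by rewrite /Jmul scaler_sumr. Qed.

End Geps.

Section GepsCalculus.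
Variables (R : realType) (n : nat).
Local Notation C := R[i].
Implicit Types (U : set 'rV[R]_n) (x : 'rV[R]_n) (i : 'I_n).

Lemma cmx_derive_conj p q (A : 'rV[R]_n -> 'M[C]_(p, q)) A' i x :
  cmx_derive i x A A' -> cmx_derive i x (fun y => conjmx (A y)) (conjmx A').
Proof.
move=> dA; apply: (@cmx_derive_tr _ _ _ _ (fun y => map_mx conjc (A y))).
move=> k l; have [dR dI] := dA k l; rewrite mxE; split.
  rewrite (_ : complex.Re _ = complex.Re (A' k l)); last by case: (A' k l).
  by move: dR; congr is_derive; apply/funext => y; rewrite mxE; case: (A y k l).
rewrite (_ : complex.Im _ = - complex.Im (A' k l)); last by case: (A' k l).
rewrite [X in is_derive _ _ X](_ : _ = fun y => - complex.Im (A y k l)).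
  exact: is_deriveN.
by apply/funext => y; rewrite mxE; case: (A y k l).
Qed.

Lemma geps_derive (eps : R) (A B : 'rV[R]_n -> 'rV[C]_n.+1) A' B' i x :
  cmx_derive i x A A' -> cmx_derive i x B B' ->
  is_derive x (delta_mx 0 i) (fun y => geps eps (A y) (B y))
    (geps eps A' (B x) + geps eps (A x) B').
Proof.
move=> dA dB.
have := cmx_deriveM (cmx_deriveM dA (cmx_derive_cst (head_diag n (eps%:C)%C) i x))
  (cmx_derive_conj dB).
move=> /(_ 0 0)[+ _]; rewrite mulmx0 addr0 mxE ReD -!gepsE.
by congr is_derive; apply/funext => y; rewrite gepsE.
Qed.

Lemma cmx_derive_Z p q (a : 'rV[R]_n -> R) a' (A : 'rV[R]_n -> 'M[C]_(p, q)) A' i x :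
  is_derive x (delta_mx 0 i) a a' -> cmx_derive i x A A' ->
  cmx_derive i x (fun y => (a y)%:C%C *: A y) ((a'%:C)%C *: A x + ((a x)%:C)%C *: A').
Proof.
move=> da dA k l; have [dR dI] := dA k l; split.
  rewrite [X in is_derive _ _ X](_ : _ = fun y => a y * complex.Re (A y k l)).
    apply: (is_derive_eq (is_deriveM da dR)).
    by rewrite !mxE ReD !ReM /GRing.scale /=; ring.
  by apply/funext => y; rewrite mxE ReM /=; ring.
rewrite [X in is_derive _ _ X](_ : _ = fun y => a y * complex.Im (A y k l)).
  apply: (is_derive_eq (is_deriveM da dI)).
  by rewrite !mxE ImD !ImM /GRing.scale /=; ring.
by apply/funext => y; rewrite mxE ImM /=; ring.
Qed.

Lemma cmx_derive_Zc p q (a : C) (A : 'rV[R]_n -> 'M[C]_(p, q)) A' i x :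
  cmx_derive i x A A' -> cmx_derive i x (fun y => a *: A y) (a *: A').
Proof.
move=> dA; have := cmx_deriveM (cmx_derive_cst (a%:M : 'M[C]_p) i x) dA.
rewrite mul0mx add0r mul_scalar_mx.
by congr cmx_derive; apply/funext => y; rewrite mul_scalar_mx.
Qed.

Lemma cmx_derive_sum p q (I : Type) (r : seq I) (A : I -> 'rV[R]_n -> 'M[C]_(p, q))
    A' i x : (forall k, cmx_derive i x (A k) (A' k)) ->
  cmx_derive i x (fun y => \sum_(k <- r) A k y) (\sum_(k <- r) A' k).
Proof.
move=> dA; elim: r => [|k r IH].
  rewrite big_nil; have := cmx_derive_cst (0 : 'M[C]_(p, q)) i x.
  by congr cmx_derive; apply/funext => y; rewrite big_nil.
rewrite big_cons; have := cmx_deriveD (dA k) IH.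
by congr cmx_derive; apply/funext => y; rewrite big_cons.
Qed.

Lemma csmooth_cmx p U (F : 'rV[R]_n -> 'rV[C]_p) : open U ->
  csmooth_on U F <-> smooth_cmx U F.
Proof.
move=> oU; rewrite /csmooth_on (smooth_mxP _ oU) (smooth_mxP _ oU); split.
  move=> [sR sI] k l; move: (sR k l) (sI k l).
  rewrite (_ : (fun y => re_mx (F y) k l) = (fun y => complex.Re (F y k l))).
    rewrite (_ : (fun y => im_mx (F y) k l) = (fun y => complex.Im (F y k l)))//.
    by apply/funext => y; rewrite mxE.
  by apply/funext => y; rewrite mxE.
move=> sF; split=> k l; have [sR sI] := sF k l.
  by move: sR; congr smooth_on; apply/funext => y; rewrite mxE.
by move: sI; congr smooth_on; apply/funext => y; rewrite mxE.
Qed.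

Lemma cpd_val p (F : 'rV[R]_n -> 'rV[C]_p) F' i x :
  cmx_derive i x F F' -> cpd i F x = F'.
Proof.
move=> dF; apply/matrixP => a k; rewrite ord1 mxE.
have E (f : C -> R) (d : C -> R) :
   (forall a b, is_derive x (delta_mx 0 i) (fun y => f (F y a b)) (d (F' a b))) ->
   pd i (fun y => map_mx f (F y)) x 0 k = d (F' 0 k).
  move=> df.
  have EF b l : (fun y => map_mx f (F y) b l) = (fun y => f (F y b l)).
    by apply/funext => y; rewrite mxE.
  rewrite pd_mxE => [|b l]; rewrite EF; last exact: (@ex_derive _ _ _ _ _ _ _ (df b l)).
  exact: (@derive_val _ _ _ _ _ _ _ (df 0 k)).
have ER := E (@complex.Re R) (@complex.Re R) (fun b l => (dF b l).1).
have EI := E (@complex.Im R) (@complex.Im R) (fun b l => (dF b l).2).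
by rewrite /re_mx /im_mx ER EI; case: (F' 0 k).
Qed.

Lemma cpdP p U (F : 'rV[R]_n -> 'rV[C]_p) i x : open U -> csmooth_on U F -> U x ->
  cmx_derive i x F (cpd i F x).
Proof.
move=> oU /(csmooth_cmx _ oU) sF Ux; have dF := smooth_cmx_derive i sF Ux.
by rewrite (cpd_val dF).
Qed.

Lemma csmooth_cpd p U (F : 'rV[R]_n -> 'rV[C]_p) i : open U ->
  csmooth_on U F -> csmooth_on U (cpd i F).
Proof.
move=> oU [sR sI]; split.
  move: (smooth_on_pd i sR); congr smooth_on; apply/funext => y.
  by apply/matrixP => a k; rewrite ord1 !mxE.
move: (smooth_on_pd i sI); congr smooth_on; apply/funext => y.
by apply/matrixP => a k; rewrite ord1 !mxE.
Qed.

(** The symmetry of second derivatives for complex maps, used on the third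
    derivatives of an immersion. *)
Lemma cpd_comm p U (F : 'rV[R]_n -> 'rV[C]_p) i j x : open U ->
  csmooth_on U F -> U x -> cpd i (cpd j F) x = cpd j (cpd i F) x.
Proof.
move=> oU sF Ux; have sFc := (csmooth_cmx F oU).1 sF.
have E k l y : U y -> cpd k F y 0 l = Complex (pd k (fun y => complex.Re (F y 0 l)) y)
   (pd k (fun y => complex.Im (F y 0 l)) y).
  by move=> Uy; rewrite (cpd_val (smooth_cmx_derive k sFc Uy)) mxE.
have D k l : cmx_derive k x (cpd l F) (cpd k (cpd l F) x).
  exact: cpdP oU (csmooth_cpd _ oU sF) Ux.
apply/matrixP => a l; rewrite ord1.
have D' k k' : cpd k (cpd k' F) x 0 l =
   Complex (pd k (pd k' (fun y => complex.Re (F y 0 l))) x)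
           (pd k (pd k' (fun y => complex.Im (F y 0 l))) x).
  have [[_ dR] [_ dI]] := D k k' 0 l.
  rewrite [LHS](_ : _ = Complex (complex.Re (cpd k (cpd k' F) x 0 l))
     (complex.Im (cpd k (cpd k' F) x 0 l))); last by case: (cpd _ _ _ _ _).
  rewrite -dR -dI; congr Complex.
    by apply: (pd_eq _ oU Ux) => y Uy; rewrite E.
  by apply: (pd_eq _ oU Ux) => y Uy; rewrite E.
have [sR sI] := sFc 0 l.
exact: (etrans (D' i j) (etrans (congr2 _ (pd_comm i j oU sR Ux)
  (pd_comm i j oU sI Ux)) (esym (D' j i)))).
Qed.

End GepsCalculus.

(** * Levi-Civita connection of a diagonal metric *)

Section DiagonalMetric.
Variables (R : realType) (n : nat).
Local Notation l := (lift (ord0 : 'I_n.+1)).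
Variables (U : set 'rV[R]_n) (g : 'rV[R]_n -> 'M[R]_n) (v : 'I_n -> 'rV[R]_n -> R).
Hypothesis oU : open U.
Hypothesis sv : forall i, smooth_on U (v i : 'rV[R]_n -> R).
Hypothesis v0 : forall i x, U x -> v i x != 0.
Hypothesis gE : forall i j x, U x -> g x i j = if i == j then v i x ^+ 2 else 0.

Lemma diag_metric_inv x : U x ->
  invmx (g x) = diag_mx (\row_k (v k x)^-2).
Proof.
move=> Ux; set B := diag_mx _.
have Bg : B *m g x = 1%:M.
  apply/matrixP => i j; rewrite mul_diag_mx !mxE gE//.
  by case: eqP => _; rewrite ?mulr0// mulVf// expf_neq0// v0.
have [ug _] := mulmx1_unit (mulmx1C Bg).
by apply: (can_inj (mulmxK ug)); rewrite Bg mulVmx.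
Qed.

Lemma diag_metric_unit x : U x -> g x \in unitmx.
Proof.
move=> Ux; have Bg : diag_mx (\row_k (v k x)^-2) *m g x = 1%:M.
  apply/matrixP => i j; rewrite mul_diag_mx !mxE gE//.
  by case: eqP => _; rewrite ?mulr0// mulVf// expf_neq0// v0.
by have [] := mulmx1_unit (mulmx1C Bg).
Qed.

Lemma is_derive_diag_metric i j k x : U x ->
  is_derive x (delta_mx 0 i) (fun y => g y j k)
    (if j == k then 2 * v j x * pd i (v j) x else 0).
Proof.
move=> Ux; have [->|jk] := eqVneq j k.
  apply: (near_eq_is_derive (f := fun y => v k y * v k y)).
    by apply: (near_eq_open oU Ux) => y Uy; rewrite gE// eqxx expr2.
  apply: (is_derive_eq (is_deriveM (is_derive_pd i (sv k) Ux) (is_derive_pd i (sv k) Ux))).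
  by rewrite /GRing.scale /=; ring.
apply: (near_eq_is_derive (f := fun=> 0 : R)).
by apply: (near_eq_open oU Ux) => y Uy; rewrite gE// (negPf jk).
Qed.

Lemma pd_diag_metric i j k x : U x ->
  pd i g x j k = if j == k then 2 * v j x * pd i (v j) x else 0.
Proof.
move=> Ux; rewrite pd_mxE => [|a b].
  exact: (@derive_val _ _ _ _ _ _ _ (is_derive_diag_metric i j k Ux)).
exact: (@ex_derive _ _ _ _ _ _ _ (is_derive_diag_metric i a b Ux)).
Qed.

Lemma christoffel_diag i j k x : U x ->
  christoffel g i j k x * v k x ^+ 2 =
  (if j == k then v j x * pd i (v j) x else 0)
  + (if i == k then v i x * pd j (v i) x else 0)
  - (if i == j then v i x * pd k (v i) x else 0).
Proof.
move=> Ux; rewrite /christoffel diag_metric_inv//.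
have vk := v0 k Ux.
rewrite (eq_bigr (fun q => diag_mx (\row_k (v k x)^-2) k q *
    ((if j == q then 2 * v j x * pd i (v j) x else 0)
     + (if i == q then 2 * v i x * pd j (v i) x else 0)
     - (if i == j then 2 * v i x * pd q (v i) x else 0)))); last first.
  by move=> q _; congr (_ * (_ + _ - _)); exact: pd_diag_metric.
rewrite (bigD1 k)//= big1 ?addr0.
  rewrite !mxE eqxx mulr1n.
  by case: (j == k); case: (i == k); case: (i == j); field.
by move=> q qk; rewrite !mxE eq_sym (negPf qk) mul0r.
Qed.

Variable h : 'I_n -> 'I_n -> 'rV[R]_n -> R.
Hypothesis pdv : forall i j x, U x -> i != j -> pd j (v i) x = h j i x * v j x.

(** In the orthonormal frame e_k = d_k / v_k the Levi-Civita connection is the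
    tangential block of the connection matrix. *)
Lemma christoffel_frame_conn (c : R) i j k x : U x ->
  christoffel g i j k x * v k x =
  (if j == k then pd i (v j) x else 0)
  + v j x * frame_conn c (v^~ x) (fun a b => h a b x) i (l j) (l k).
Proof.
move=> Ux; have vk := v0 k Ux; apply: (mulIf vk).
rewrite -mulrA -expr2 christoffel_diag// mxE !liftK.
have [ji|ji] := eqVneq j i.
  rewrite ji; have [ki|ki] := eqVneq k i.
    by rewrite ki; ring.
  by rewrite (pdv Ux) 1?eq_sym//; ring.
have [ki|ki] := eqVneq k i.
  by rewrite ki (negPf ji) (pdv Ux) 1?eq_sym//; ring.
by have [->|jk] := eqVneq j k; ring.
Qed.

End DiagonalMetric.

(** * Structure equations of a horizontal immersion *)

Section PrincipalStructure.
Variables (R : realType) (n : nat) (eps c : R).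
Local Notation C := R[i].
Local Notation l := (lift (ord0 : 'I_n.+1)).
Implicit Types (U : set 'rV[R]_n) (g : 'rV[R]_n -> 'M[R]_n)
  (F : 'rV[R]_n -> 'rV[C]_n.+1) (v : 'I_n -> 'rV[R]_n -> R)
  (h : 'I_n -> 'I_n -> 'rV[R]_n -> R).

(** Everything that the geometry gives on the first and second derivatives of
    F: orthogonality relations, and the Gauss formula with second fundamental
    form delta_ij i d_i F. The metric g enters only through its Christoffel
    symbols and the Gram matrix, so that the notion serves both for the given
    immersion and for the transformed one. *)
Definition principal_structure U g F := forall x, U x ->
  [/\ geps eps (F x) (F x) = c^-1,
      forall q, geps eps (F x) (cpd q F x) = 0 /\
                geps eps (Jmul (F x)) (cpd q F x) = 0,
      forall k q, geps eps (cpd k F x) (cpd q F x) = g x k q /\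
                  geps eps (Jmul (cpd k F x)) (cpd q F x) = 0 &
      forall i j, cpd i (cpd j F) x =
        \sum_k ((christoffel g i j k x)%:C)%C *: cpd k F x
        - ((c * g x i j)%:C)%C *: F x
        + (if i == j then Jmul (cpd i F x) else 0)].

Lemma differential_delta F x i :
  differential F x (delta_mx 0 i) = cpd i F x.
Proof.
rewrite /differential (bigD1 i)//= big1 ?addr0.
  by rewrite mxE !eqxx scale1r.
by move=> k ki; rewrite mxE (negPf ki) andbF scale0r.
Qed.

Lemma innerE g x X Y : inner g x X Y = \sum_i \sum_j X 0 i * Y 0 j * g x i j.
Proof.
rewrite /inner mxE exchange_big /=; apply: eq_bigr => j _.
rewrite mxE mulr_suml; apply: eq_bigr => i _; rewrite mxE; ring.
Qed.

Lemma inner_delta g x i j : inner g x (delta_mx 0 i) (delta_mx 0 j) = g x i j.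
Proof. by rewrite /inner -rowE trmx_delta -colE !mxE. Qed.

Lemma is_derive_uniq (x u : 'rV[R]_n) (f : 'rV[R]_n -> R) (a b : R) :
  is_derive x u f a -> is_derive x u f b -> a = b.
Proof. by move=> [_ <-] [_ <-]. Qed.

(** A relation that holds identically on an open set yields the relation
    between derivatives. *)
Lemma is_derive_locally_cst U x u (f : 'rV[R]_n -> R) (a b : R) : open U -> U x ->
  (forall y, U y -> f y = a) -> is_derive x u f b -> b = 0.
Proof.
move=> oU Ux fa df; apply: (is_derive_uniq df).
apply: (near_eq_is_derive (f := fun=> a)).
by apply: (near_eq_open oU Ux) => y Uy; rewrite fa.
Qed.

(** The orthogonality relations come by differentiating g(F, F) = 1/c and the
    horizontality g(iF, d_j F) = 0; the Gauss formula is the definition of the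
    second fundamental form solved for d_i d_j F. That formula gives g(iF, d_i
    d_j F) = 0, whence g(i d_i F, d_j F) = 0. *)
Lemma associated_structure U g F v h :
  open U -> 0 < eps * c -> isometric_immersion eps c U g F ->
  horizontal eps c U F -> associated_solution eps c U g F v h ->
  principal_structure U g F.
Proof.
move=> oU epsc [sF sphF _ isoF] horF [_ _ alphaE _ _].
have c0 : c != 0 by apply: contraTneq epsc => ->; rewrite mulr0 ltxx.
have dF k y : U y -> cmx_derive k y F (cpd k F y) by exact: cpdP.
have ddF k q y : U y -> cmx_derive k y (cpd q F) (cpd k (cpd q F) y).
  by move=> Uy; exact: cpdP oU (csmooth_cpd q oU sF) Uy.
have gFF y : U y -> geps eps (F y) (F y) = c^-1 by exact: sphF.
have gFf q y : U y -> geps eps (F y) (cpd q F y) = 0.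
  move=> Uy; have := is_derive_locally_cst oU Uy gFF
    (geps_derive eps (dF q y Uy) (dF q y Uy)).
  by rewrite gepsC -mulr2n => /eqP; rewrite mulrn_eq0 => /eqP.
have gff k q y : U y -> geps eps (cpd k F y) (cpd q F y) = g y k q.
  by move=> Uy; rewrite -!differential_delta isoF// inner_delta.
have gJFf q y : U y -> geps eps (Jmul (F y)) (cpd q F y) = 0.
  move=> Uy; have := horF y (delta_mx 0 q) Uy.
  rewrite differential_delta gepsZ1 => /eqP; rewrite mulf_eq0 => /orP[|/eqP//].
  by rewrite gt_eqF// sqrtr_gt0 normr_gt0.
have gFdf i j y : U y -> geps eps (cpd i (cpd j F) y) (F y) = - g y i j.
  move=> Uy; have := is_derive_locally_cst oU Uy (gFf j)
    (geps_derive eps (dF i y Uy) (ddF i j y Uy)).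
  by rewrite gff// [geps _ (F y) _]gepsC addrC => /eqP; rewrite addr_eq0 => /eqP.
have gauss i j y : U y -> cpd i (cpd j F) y =
        \sum_k ((christoffel g i j k y)%:C)%C *: cpd k F y
        - ((c * g y i j)%:C)%C *: F y
        + (if i == j then Jmul (cpd i F y) else 0).
  move=> Uy; have := alphaE i j y Uy; rewrite /second_ff /tangent_proj gFdf//.
  rewrite /phi_tensor /tangent_proj [geps _ (Jmul _) _]gepsC geps_J2 gJFf//.
  rewrite oppr0 mulr0 scale0r subr0 => <-.
  rewrite mulrN raddfN scaleNr opprK.
  by rewrite [RHS]addrC addrA subrK addrK.
have gJff k q y : U y -> geps eps (Jmul (cpd k F y)) (cpd q F y) = 0.
  move=> Uy; have := is_derive_locally_cst oU Uy (gJFf q)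
    (geps_derive eps (cmx_derive_Zc 'i%C (dF k y Uy)) (ddF k q y Uy)).
  rewrite gauss// gepsD2 gepsD2 geps_sum2 big1; last first.
    by move=> p _; rewrite gepsZ2 gJFf// mulr0.
  rewrite gepsN2 (gepsZ2 eps (c * g y k q) (Jmul (F y)) (F y)).
  rewrite (geps_Jzz eps (F y)) mulr0 oppr0 !add0r.
  case: eqP => _; last by rewrite geps0r addr0.
  by rewrite geps_JJ gFf// addr0.
by move=> x Ux; split=> //; [exact: gFF|split; [exact: gFf|exact: gJFf]
  |split; [exact: gff|exact: gJff]|move=> i j; exact: gauss].
Qed.

End PrincipalStructure.

(** * Moving frames *)

Section Frames.
Variables (R : realType) (n : nat) (eps c : R).
Local Notation C := R[i].
Local Notation o := (ord0 : 'I_n.+1).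
Local Notation l := (lift (ord0 : 'I_n.+1)).
Implicit Types (U : set 'rV[R]_n) (g : 'rV[R]_n -> 'M[R]_n)
  (F : 'rV[R]_n -> 'rV[C]_n.+1) (v : 'I_n -> 'rV[R]_n -> R)
  (h : 'I_n -> 'I_n -> 'rV[R]_n -> R) (Psi : 'rV[R]_n -> 'M[C]_n.+1).

Definition cframe_conn v h i (x : 'rV[R]_n) : 'M[C]_n.+1 :=
  map_mx (real_complex R) (frame_conn c (v^~ x) (fun a b => h a b x) i).

(** The linear system and the unitarity relation that characterise the frame
    of a horizontal immersion. *)
Definition moving_frame U v h Psi :=
  (forall i x, U x -> cmx_derive i x Psi
     (cframe_conn v h i x *m Psi x + 'i%C *: (leg_proj C i *m Psi x))) /\
  (forall x, U x ->
     Psi x *m head_diag n (eps%:C)%C *m conjmx (Psi x) = head_diag n (c^-1%:C)%C).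

Lemma cmx_derive_row p q i x (A : 'rV[R]_n -> 'M[C]_(p, q)) A' a :
  cmx_derive i x A A' -> cmx_derive i x (fun y => row a (A y)) (row a A').
Proof.
move=> dA k b; have [dR dI] := dA a b; rewrite !mxE.
by split; [move: dR|move: dI]; congr is_derive; apply/funext => y; rewrite mxE.
Qed.

Lemma cmx_derive_row_stack p q i x (X : 'rV[R]_n -> 'rV[C]_q)
    (Y : 'I_p -> 'rV[R]_n -> 'rV[C]_q) X' Y' :
  cmx_derive i x X X' -> (forall j, cmx_derive i x (Y j) (Y' j)) ->
  cmx_derive i x (fun y => row_stack (X y) (Y^~ y)) (row_stack X' Y').
Proof.
move=> dX dY a b; case: (unliftP ord0 a) => [j|] ->.
  rewrite row_stackS; have [dR dI] := dY j 0 b.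
  by split; [move: dR|move: dI]; congr is_derive; apply/funext => y; rewrite row_stackS.
rewrite row_stack0; have [dR dI] := dX 0 b.
by split; [move: dR|move: dI]; congr is_derive; apply/funext => y; rewrite row_stack0.
Qed.

Lemma row_leg_proj q (G : 'M[C]_(n.+1, q)) i j :
  row (l j) (leg_proj C i *m G) = if i == j then row (l i) G else 0.
Proof.
apply/matrixP => a b; rewrite mxE leg_proj_mul lift0_eq eq_sym.
by case: eqP => _; rewrite mxE.
Qed.

Section Gauss.
Variables (U : set 'rV[R]_n) (g : 'rV[R]_n -> 'M[R]_n) (v : 'I_n -> 'rV[R]_n -> R).
Variable h : 'I_n -> 'I_n -> 'rV[R]_n -> R.
Hypothesis oU : open U.
Hypothesis sv : forall i, smooth_on U (v i : 'rV[R]_n -> R).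
Hypothesis v0 : forall i x, U x -> v i x != 0.
Hypothesis gE : forall i j x, U x -> g x i j = if i == j then v i x ^+ 2 else 0.
Hypothesis pdv : forall i j x, U x -> i != j -> pd j (v i) x = h j i x * v j x.

(** The Levi-Civita part and the umbilical part of the Gauss formula together
    are the product rule for d_j F = v_j e_j, with the derivative of e_j given
    by the connection matrix. *)
Lemma christoffel_frame (x : 'rV[R]_n) (G : 'M[C]_n.+1) i j : U x ->
  \sum_k ((christoffel g i j k x)%:C)%C *: (((v k x)%:C)%C *: row (l k) G)
   - ((c * g x i j)%:C)%C *: row o G
  = ((pd i (v j) x)%:C)%C *: row (l j) G
    + ((v j x)%:C)%C *: row (l j) (cframe_conn v h i x *m G).
Proof.
move=> Ux; have E k : ((christoffel g i j k x)%:C)%C *: (((v k x)%:C)%C *: row (l k) G)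
   = (if j == k then ((pd i (v j) x)%:C)%C *: row (l k) G else 0)
     + ((v j x)%:C)%C *: (cframe_conn v h i x (l j) (l k) *: row (l k) G).
  rewrite scalerA -rmorphM /= (christoffel_frame_conn oU sv v0 gE pdv c)//.
  rewrite [cframe_conn _ _ _ _ _ _]mxE rmorphD rmorphM /= scalerDl scalerA; congr (_ + _).
  by case: eqP => // _; rewrite rmorph0 scale0r.
under eq_bigr do rewrite E.
rewrite big_split /= -big_mkcond /= (big_pred1 j); last first.
  by move=> k; rewrite eq_sym.
rewrite -addrA; congr (_ + _).
rewrite -scaler_sumr; apply/matrixP => a b; rewrite ord1 !mxE.
rewrite big_ord_recl /= mulrDr addrC; congr (_ + _); last first.
  by rewrite summxE; congr (_ * _); apply: eq_bigr => k _; rewrite !mxE.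
rewrite [cframe_conn _ _ _ _ _ _]mxE frame_conn_S0 gE// mulrA -mulNr; congr (_ * _).
rewrite -rmorphM -rmorphN /=; congr ((_)%:C)%C.
rewrite eq_sym; case: eqP => [->|_]; last by rewrite !mulr0 oppr0.
ring.
Qed.

Lemma structure_frame F : csmooth_on U F -> principal_structure eps c U g F ->
  moving_frame U v h
    (fun y => row_stack (F y) (fun j => (((v j y)^-1)%:C)%C *: cpd j F y)).
Proof.
move=> sF psF; set Psi := fun y => _.
have row0 y : row o (Psi y) = F y.
  by apply/matrixP => a b; rewrite ord1 mxE row_stack0.
have rowS y j : row (l j) (Psi y) = (((v j y)^-1)%:C)%C *: cpd j F y.
  by apply/matrixP => a b; rewrite ord1 mxE row_stackS.
have fE y j : U y -> cpd j F y = ((v j y)%:C)%C *: row (l j) (Psi y).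
  by move=> Uy; rewrite rowS scalerA -rmorphM mulfV ?v0// rmorph1 scale1r.
split=> [i x Ux|x Ux].
  have vx k := v0 k Ux.
  have dF k : cmx_derive k x F (cpd k F x) by exact: (cpdP k oU sF Ux).
  have [_ _ _ gauss] := psF x Ux.
  have dY j : cmx_derive i x (fun y => (((v j y)^-1)%:C)%C *: cpd j F y)
      (row (l j) (cframe_conn v h i x *m Psi x + 'i%C *: (leg_proj C i *m Psi x))).
    have dvV : is_derive x (delta_mx 0 i) (fun y => (v j y)^-1)
        (- (v j x) ^- 2 * pd i (v j) x).
      have [dv _] := is_derive_pd i (sv j) Ux.
      by split; [exact: derivableV|rewrite deriveV].
    have := cmx_derive_Z dvV (cpdP i oU (csmooth_cpd j oU sF) Ux).
    congr cmx_derive; rewrite gauss.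
    under eq_bigr do rewrite (fE x)//.
    rewrite -(row0 x) christoffel_frame// !scalerDr !scalerA -!rmorphM /=.
    rewrite (fE x j Ux) scalerA -rmorphM /= addrA addrA -scalerDl -rmorphD /=.
    rewrite (_ : _ + _ = 0 :> R) ?rmorph0 ?scale0r ?add0r; last by field.
    rewrite mulVf// rmorph1 scale1r linearD /= linearZ /=; congr (_ + _).
    rewrite row_leg_proj; case: eqP => [->|_]; last by rewrite !scaler0.
    by rewrite rowS /Jmul !scalerA mulrC.
  have := cmx_derive_row_stack (dF i) dY; congr cmx_derive; apply: row_stackP => [b|j b].
    rewrite row_stack0 mxDE mxZE leg_proj_mul mulr0 addr0.
    have -> : cframe_conn v h i x = frame_conn ((c%:C)%C : C) (fun k => ((v k x)%:C)%C)
      (fun a b => ((h a b x)%:C)%C) i by exact: map_frame_conn.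
    by rewrite frame_conn_mul0 (fE x i Ux) !mxE.
  by rewrite row_stackS mxE.
have [gFF gFf gff _] := psF x Ux.
apply/matrixP => a b; rewrite herm_row herm_parts.
have vx k := v0 k Ux.
case: (unliftP o a) => [j|] ->; case: (unliftP o b) => [k|] ->;
  rewrite ?row0 ?rowS ?JmulZ ?gepsZ1 ?gepsZ2 mxE ?lift0_eq ?lift0_neq ?neq_lift0 ?eqxx /=.
- have [-> ->] := gff j k; rewrite gE// !mulr0 oppr0.
  case: eqP => [->|_]; last by rewrite !mulr0.
  by congr Complex; field.
- have [gFj gJFj] := gFf j; rewrite gepsC gFj.
  by rewrite gepsC geps_J2 gJFj oppr0 !mulr0 oppr0.
- by have [-> ->] := gFf k; rewrite !mulr0 oppr0.
- by rewrite gFF geps_Jzz oppr0.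
Qed.

Lemma frame_structure Psi : smooth_cmx U Psi -> moving_frame U v h Psi ->
  principal_structure eps c U g (fun y => row o (Psi y)).
Proof.
move=> sPsi [dPsi uPsi]; set F := fun y => _.
have fE y j : U y -> cpd j F y = ((v j y)%:C)%C *: row (l j) (Psi y).
  move=> Uy; rewrite (cpd_val (cmx_derive_row o (dPsi j y Uy))).
  apply/matrixP => a b; rewrite ord1 mxE mxDE mxZE leg_proj_mul mulr0 addr0.
  have -> : cframe_conn v h j y = frame_conn ((c%:C)%C : C) (fun k => ((v k y)%:C)%C)
    (fun a b => ((h a b y)%:C)%C) j by exact: map_frame_conn.
  by rewrite frame_conn_mul0 !mxE.
move=> x Ux; have u a b : herm eps (row a (Psi x)) (row b (Psi x))
    = head_diag n (c^-1%:C)%C a b by rewrite -(uPsi x Ux) herm_row.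
have ug a b : geps eps (row a (Psi x)) (row b (Psi x))
    = complex.Re (head_diag n (c^-1%:C)%C a b) by rewrite -u herm_parts.
have uJ a b : geps eps (Jmul (row a (Psi x))) (row b (Psi x)) = 0.
  have := congr1 (@complex.Im R) (u a b).
  rewrite (herm_parts eps (row a (Psi x)) (row b (Psi x))) [head_diag _ _ _ _]mxE /= => e.
  by apply/eqP; rewrite -oppr_eq0 e; case: (a == b); case: (a == o).
split.
- by rewrite ug mxE eqxx.
- by move=> q; rewrite fE// !gepsZ2 ug uJ mxE !mulr0.
- move=> k q; rewrite !fE// JmulZ !gepsZ1 !gepsZ2 ug uJ !mulr0 mxE lift0_eq gE//.
  by case: eqP => [->|_]; rewrite /= ?mulr0// mulr1 expr2.
move=> i j.
have -> : cpd i (cpd j F) x = ((pd i (v j) x)%:C)%C *: row (l j) (Psi x)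
    + ((v j x)%:C)%C *: row (l j) (cframe_conn v h i x *m Psi x + 'i%C *: (leg_proj C i *m Psi x)).
  apply: cpd_val.
  apply: (@cmx_derive_near _ _ _ _ _ (fun y => ((v j y)%:C)%C *: row (l j) (Psi y)) _ _ _ _ oU Ux).
    by move=> y Uy; rewrite fE.
  exact: cmx_derive_Z (is_derive_pd i (sv j) Ux) (cmx_derive_row (l j) (dPsi i x Ux)).
under eq_bigr do rewrite (fE x)//.
rewrite christoffel_frame// linearD /= scalerDr addrA; congr (_ + _).
rewrite linearZ /= row_leg_proj; case: eqP => [->|_]; last by rewrite !scaler0.
by rewrite fE// /Jmul !scalerA mulrC.
Qed.

End Gauss.

End Frames.

(** * Constant curvature from the structure equations *)

Lemma smooth_christoffel (R : realType) (n : nat) (U : set 'rV[R]_n)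
  (g : 'rV[R]_n -> 'M[R]_n) i j k : open U -> smooth_on U g ->
  (forall x, U x -> g x \in unitmx) ->
  smooth_on U (christoffel g i j k : 'rV[R]_n -> R).
Proof.
move=> oU sg ug; have sge a b := (smooth_mxP g oU).1 sg a b.
have sinv a b := smooth_invmx oU sge ug a b.
have spd a b d : smooth_on U (fun x => pd a g x b d).
  exact: ((smooth_mxP (pd a g) oU).1 (smooth_on_pd a sg) b d).
apply: (smoothM oU (smooth_cst 2^-1 oU)); apply: (smooth_sum _ oU) => q _.
apply: (smoothM oU (sinv k q)).
exact: (smoothD oU (smoothD oU (spd i j q) (spd j i q)) (smoothN oU (spd q i j))).
Qed.

Section SpaceForm.
Variables (R : realType) (n : nat) (c : R).
Variables (U : set 'rV[R]_n) (g : 'rV[R]_n -> 'M[R]_n).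

(** The curvature operator of a space form determines the sectional curvature,
    since the Gram determinant of two independent vectors does not vanish. *)
Lemma constant_curvatureP :
  (forall x, U x -> (g x)^T = g x) ->
  (forall x X, U x -> X != 0 -> 0 < inner g x X X) ->
  (forall x i j k q, U x -> riemann_coef g x i j k q =
     c * (g x j k * (i == q)%:R - g x i k * (j == q)%:R)) ->
  constant_curvature U g c.
Proof.
move=> trg posg rg x X Y Ux fXY.
have indep (a b : R) : a *: X + b *: Y = 0 -> a = 0 /\ b = 0.
  move=> e; have : row_mx a%:M b%:M *m col_mx X Y == 0.
    by rewrite mul_row_col !mul_scalar_mx e.
  rewrite mulmx_free_eq0// row_mx_eq0 => /andP[/eqP/matrixP/(_ 0 0) + /eqP/matrixP/(_ 0 0)].
  by rewrite !mxE eqxx !mulr1n.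
have Y0 : Y != 0.
  apply/eqP => Y0; have [] := indep 0 1.
    by rewrite Y0 scaler0 addr0 scale0r.
  by move=> _ /eqP; rewrite oner_eq0.
have gYY := posg x Y Ux Y0.
have innerDl A B D : inner g x (A + B) D = inner g x A D + inner g x B D.
  by rewrite /inner !mulmxDl mxE.
have innerZl a A B : inner g x (a *: A) B = a * inner g x A B.
  by rewrite /inner -!scalemxAl mxE.
have innerC A B : inner g x A B = inner g x B A.
  rewrite /inner; transitivity ((A *m g x *m B^T)^T 0 0); first by rewrite [RHS]mxE.
  by rewrite !trmx_mul trmxK trg// mulmxA.
have curvE : curvature g x X Y Y = c *: (inner g x Y Y *: X - inner g x X Y *: Y).
  apply/matrixP => a q; rewrite ord1 !mxE !innerE.
  transitivity (\sum_i \sum_j \sum_k (c * X 0 i * (i == q)%:R * (Y 0 j * Y 0 k * g x j k)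
     - c * (Y 0 j * (j == q)%:R) * (X 0 i * Y 0 k * g x i k))).
    apply: eq_bigr => i _; apply: eq_bigr => j _; apply: eq_bigr => k _.
    by rewrite rg//; ring.
  have delta_sum (Z : 'rV[R]_n) : \sum_i Z 0 i * (i == q)%:R = Z 0 q.
    rewrite (bigD1 q)//= eqxx mulr1 big1 ?addr0// => i /negPf ->.
    by rewrite mulr0.
  under eq_bigr do under eq_bigr do rewrite sumrB.
  under eq_bigr do rewrite sumrB.
  rewrite sumrB mulrBr; congr (_ - _).
    transitivity (\sum_i X 0 i * (i == q)%:R * (c * inner g x Y Y)).
      apply: eq_bigr => i _; rewrite innerE !mulr_sumr; apply: eq_bigr => j _.
      by rewrite !mulr_sumr; apply: eq_bigr => k _; ring.
    by rewrite -mulr_suml delta_sum innerE; ring.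
  transitivity (\sum_i (\sum_j Y 0 j * (j == q)%:R) * (c * \sum_k X 0 i * Y 0 k * g x i k)).
    apply: eq_bigr => i _; rewrite mulr_suml; apply: eq_bigr => j _.
    by rewrite !mulr_sumr; apply: eq_bigr => k _; ring.
  by rewrite -mulr_sumr delta_sum -mulr_sumr; ring.
set A := inner g x X X; set B := inner g x Y Y; set D := inner g x X Y.
have E : inner g x (curvature g x X Y Y) X = c * (A * B - D ^+ 2).
  rewrite curvE innerZl innerDl -scaleNr !innerZl (innerC Y X) -/A -/B -/D; ring.
rewrite /sectional E -/A -/B -/D mulfK//.
(* The squared length of this vector is B times the Gram determinant. *)
have Z0 : B *: X - D *: Y != 0.
  apply/eqP => e; have [B0 _] := indep B (- D) (etrans (congr1 _ (scaleNr _ _)) e).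
  by move: gYY; rewrite -/B B0 ltxx.
have := posg x _ Ux Z0.
have -> : inner g x (B *: X - D *: Y) (B *: X - D *: Y) = B * (A * B - D ^+ 2).
  rewrite innerDl -scaleNr !innerZl.
  rewrite (innerC X) (innerC Y) !innerDl !innerZl (innerC Y X) -/A -/B -/D; ring.
by rewrite pmulr_rgt0// => /gt_eqF ->.
Qed.

End SpaceForm.

Section Conclusions.
Variables (R : realType) (n : nat) (eps c : R).
Local Notation C := R[i].
Variables (U : set 'rV[R]_n) (g : 'rV[R]_n -> 'M[R]_n) (v : 'I_n -> 'rV[R]_n -> R).
Variables (h : 'I_n -> 'I_n -> 'rV[R]_n -> R) (F : 'rV[R]_n -> 'rV[C]_n.+1).
Hypothesis oU : open U.
Hypothesis v0 : forall i x, U x -> v i x != 0.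
Hypothesis gE : forall i j x, U x -> g x i j = if i == j then v i x ^+ 2 else 0.
Hypothesis hv : solves_hv_system c U v h.
Hypothesis hC : forall i j x, U x -> i != j -> h i j x = h j i x.
Hypothesis sF : csmooth_on U F.
Hypothesis psF : principal_structure eps c U g F.

Let sv i : smooth_on U (v i : 'rV[R]_n -> R).
Proof. by case: hv => [[]]. Qed.

Let sg : smooth_on U g.
Proof.
apply/(smooth_mxP _ oU) => i j.
apply: (smooth_on_eq (f := fun y => if i == j then v i y * v i y else 0) oU).
  by move=> y Uy; rewrite gE//; case: eqP => // ->; rewrite expr2.
by case: eqP => _; [exact: (smoothM oU (sv i) (sv i))|exact: (smooth_cst 0 oU)].
Qed.

Let trg x : U x -> (g x)^T = g x.
Proof.
move=> Ux; apply/matrixP => i j; rewrite mxE !gE// eq_sym.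
by case: eqP => [->|].
Qed.

Let posg x X : U x -> X != 0 -> 0 < inner g x X X.
Proof.
move=> Ux /rV0Pn[i Xi]; rewrite innerE.
have E k : \sum_j X 0 k * X 0 j * g x k j = (X 0 k * v k x) ^+ 2.
  rewrite (bigD1 k)//= big1 ?addr0; first by rewrite gE// eqxx; ring.
  by move=> j jk; rewrite gE// eq_sym (negPf jk) mulr0.
under eq_bigr do rewrite E.
rewrite (bigD1 i)//= ltr_pwDl//; last by apply: sumr_ge0 => k _; exact: sqr_ge0.
by rewrite lt_neqAle sqr_ge0 eq_sym sqrf_eq0 mulf_neq0// v0.
Qed.

(** Pair d_i d_j d_k F with the frame and use the Gauss formula twice. The
    symmetry in i and j is then the Gauss equation; the contribution of the
    second fundamental form is already symmetric, because it is supported on i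
    = j = k, and only the curvature c of the ambient sphere remains. *)
Lemma principal_riemann x i j k q : U x ->
  riemann_coef g x i j k q = c * (g x j k * (i == q)%:R - g x i k * (j == q)%:R).
Proof.
move=> Ux.
have ug y : U y -> g y \in unitmx by exact: (diag_metric_unit v0 gE).
have sGam a b d := smooth_christoffel a b d oU sg ug.
have df a : cmx_derive a x F (cpd a F x) := cpdP a oU sF Ux.
have ddf a b : cmx_derive a x (cpd b F) (cpd a (cpd b F) x).
  exact: (cpdP a oU (csmooth_cpd b oU sF) Ux).
have [gFF gFf gff gauss] := psF Ux.
have gddf a b : geps eps (cpd a (cpd b F) x) (cpd q F x)
    = christoffel g a b q x * v q x ^+ 2.
  rewrite gauss 2!gepsD1 geps_sum1 (bigD1 q)//= big1 ?addr0; last first.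
    by move=> p pq; rewrite gepsZ1 (gff p q).1 gE// (negPf pq) mulr0.
  rewrite gepsZ1 (gff q q).1 gE// eqxx gepsN1 gepsZ1 (gFf q).1 mulr0 oppr0 addr0.
  by case: eqP => _; rewrite ?geps0l ?(gff a q).2 addr0.
have gJddf a b : geps eps (Jmul (cpd a (cpd b F) x)) (cpd q F x)
    = - (if a == b then g x a q else 0).
  rewrite gauss 2!JmulD Jmul_sum 2!gepsD1 geps_sum1 big1 ?add0r; last first.
    by move=> p _; rewrite JmulZ gepsZ1 (gff p q).2 mulr0.
  rewrite JmulN JmulZ gepsN1 gepsZ1 (gFf q).2 mulr0 oppr0 add0r.
  case: eqP => _; first by rewrite JmulJ gepsN1 (gff a q).1.
  by rewrite /Jmul scaler0 geps0l oppr0.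
have gsum (t : 'I_n -> R) : \sum_p t p * g x p q = t q * v q x ^+ 2.
  rewrite (bigD1 q)//= big1 ?addr0; first by rewrite gE// eqxx.
  by move=> p pq; rewrite gE// (negPf pq) mulr0.
have third a b : geps eps (cpd a (cpd b (cpd k F)) x) (cpd q F x)
    = pd a (christoffel g b k q : 'rV[R]_n -> R) x * v q x ^+ 2
      + \sum_p christoffel g b k p x * (christoffel g a p q x * v q x ^+ 2)
      - c * g x b k * g x a q
      - (if b == k then if a == b then g x a q else 0 else 0).
  have dg : is_derive x (delta_mx 0 a) (fun y => c * g y b k)
      (c *: pd a (fun y => g y b k : R) x).
    exact: (is_deriveZ c (is_derive_pd a ((smooth_mxP g oU).1 sg b k) Ux)).
  have -> : cpd a (cpd b (cpd k F)) x =
      \sum_p (((pd a (christoffel g b k p : 'rV[R]_n -> R) x)%:C)%C *: cpd p F x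
              + ((christoffel g b k p x)%:C)%C *: cpd a (cpd p F) x)
      - (((c *: pd a (fun y => g y b k : R) x)%:C)%C *: F x
          + ((c * g x b k)%:C)%C *: cpd a F x)
      + (if b == k then Jmul (cpd a (cpd b F) x) else 0).
    apply: cpd_val.
    apply: (cmx_derive_near oU Ux (A := fun y =>
        \sum_p ((christoffel g b k p y)%:C)%C *: cpd p F y
        - ((c * g y b k)%:C)%C *: F y
        + (if b == k then Jmul (cpd b F y) else 0))).
      by move=> y Uy; have [_ _ _ ->] := psF Uy.
    apply: cmx_deriveD.
      apply: cmx_deriveB.
        apply: cmx_derive_sum => p.
        exact: (cmx_derive_Z (is_derive_pd a (sGam b k p) Ux) (ddf a p)).
      exact: (cmx_derive_Z dg (df a)).
    case: eqP => _; last exact: cmx_derive_cst.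
    exact: (cmx_derive_Zc 'i%C (ddf a b)).
  rewrite 2!gepsD1 geps_sum1.
  rewrite (eq_bigr (fun p => pd a (christoffel g b k p : 'rV[R]_n -> R) x * g x p q
     + christoffel g b k p x * (christoffel g a p q x * v q x ^+ 2))); last first.
    move=> p _; apply: etrans (gepsD1 _ _ _ _) _; congr (_ + _).
      by apply: etrans (gepsZ1 _ _ _ _) _; rewrite (gff p q).1.
    by apply: etrans (gepsZ1 _ _ _ _) _; rewrite gddf.
  rewrite big_split /= gsum gepsN1 gepsD1 (gepsZ1 eps _ (F x)) (gFf q).1 mulr0 add0r.
  rewrite (gepsZ1 eps _ (cpd a F x)) (gff a q).1.
  congr (_ + _ - _ + _).
  by case: eqP => _; [exact: gJddf|rewrite geps0l oppr0].
have e := etrans (esym (third i j)) (etrans (congr1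
  (fun z => geps eps z (cpd q F x))
  (cpd_comm i j oU (csmooth_cpd k oU sF) Ux)) (third j i)).
(* The equality of the two pairings is the claim multiplied by the squared
   length of the q-th coordinate vector. *)
have vq : v q x ^+ 2 != 0 by rewrite expf_neq0// v0.
apply: (mulIf vq); rewrite /riemann_coef sumrB.
have S a b : \sum_p christoffel g b k p x * (christoffel g a p q x * v q x ^+ 2)
    = (\sum_p christoffel g a p q x * christoffel g b k p x) * v q x ^+ 2.
  by rewrite mulr_suml; apply: eq_bigr => p _; ring.
move: e; rewrite !S.
have d a b : (if b == k then if a == b then g x a q else 0 else 0)
    = (if (b == k) && (a == b) then g x a q else 0) by case: ifP.
have gq a : g x a q = (a == q)%:R * v q x ^+ 2.
  by rewrite gE//; case: eqP => [->|_]; rewrite ?mul1r ?mul0r.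
have -> : (if j == k then if i == j then g x i q else 0 else 0)
        = (if i == k then if j == i then g x j q else 0 else 0).
  by have [->|_] := eqVneq i j; case: (j == k); case: (i == k).
rewrite !gq => e; set T1 := pd i _ x in e *; set T2 := pd j _ x in e *.
set S1 := \sum_p _ in e *; set S2 := \sum_p _ in e *.
transitivity ((T1 * v q x ^+ 2 + S1 * v q x ^+ 2) - (T2 * v q x ^+ 2 + S2 * v q x ^+ 2)).
  by ring.
move/eqP: e; rewrite -subr_eq0 => /eqP e; apply/eqP; rewrite -subr_eq0; apply/eqP.
by rewrite -{}[RHS]e; ring.
Qed.

Lemma geps_differential x X Y : U x ->
  geps eps (differential F x X) (differential F x Y) = inner g x X Y.
Proof.
move=> Ux; have [_ _ gff _] := psF Ux.
rewrite /differential innerE geps_sum1; apply: eq_bigr => i _.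
rewrite geps_sum2; apply: eq_bigr => j _.
by rewrite gepsZ1 gepsZ2 (gff i j).1 mulrA.
Qed.

(** The structure equations, with a diagonal metric and a solution of the
    system, recover all the geometric statements. *)
Lemma principal_conclusions :
  [/\ riemannian_metric U g,
      isometric_immersion eps c U g F,
      horizontal eps c U F,
      constant_curvature U g c &
      associated_solution eps c U g F v h].
Proof.
split.
- by split=> [|x Ux]; [exact: sg|split; [exact: trg|move=> X; exact: posg]].
- split; first exact: sF.
  + by move=> x Ux; have [+ _ _ _] := psF Ux.
  + move=> x X Ux dX; apply/eqP/negPn/negP => /(posg Ux).
    by rewrite -(geps_differential X X Ux) dX geps0l ltxx.
  + by move=> x X Y; exact: geps_differential.
- move=> x X Ux; have [_ gFf _ _] := psF Ux.
  rewrite gepsZ1 /differential geps_sum2 big1 ?mulr0// => k _.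
  by rewrite gepsZ2 (gFf k).2 mulr0.
- apply: (constant_curvatureP trg); first by move=> x X; exact: posg.
  by move=> x i j k q; exact: principal_riemann.
- have pdh i j x : U x -> i != j -> pd i (v j) x = h i j x * v i x.
    by move=> Ux ij; case: hv => _ -> //; rewrite eq_sym.
  split.
  + exact: v0.
  + exact: gE.
  + move=> i j x Ux; have [_ gFf gff gauss] := psF Ux.
    have gF : geps eps (cpd i (cpd j F) x) (F x) = - (c * g x i j * c^-1).
      rewrite gauss 2!gepsD1 geps_sum1 big1 ?add0r; last first.
        by move=> p _; rewrite gepsZ1 gepsC (gFf p).1 mulr0.
      rewrite gepsN1 gepsZ1; have [-> _ _ _] := psF Ux.
      case: eqP => _; last by rewrite geps0l addr0.
      by rewrite gepsC geps_J2 (gFf i).2 oppr0 addr0.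
    rewrite /second_ff /tangent_proj gF gauss /phi_tensor /tangent_proj.
    rewrite [geps _ (Jmul _) _]gepsC geps_J2 (gFf i).2 oppr0 mulr0 scale0r subr0.
    have -> : c * - (c * g x i j * c^-1) = - (c * g x i j).
      by have [->|c0] := eqVneq c 0; [rewrite !mul0r oppr0|field].
    rewrite raddfN /= scaleNr opprK.
    by rewrite [Z in Z - _]addrAC subrK addrAC subrr add0r.
  + move=> i j x Ux ij; split; first exact: hC.
    by rewrite pdh// mulrC mulfK// v0.
  + exact: hv.
Qed.

End Conclusions.

(** * Transformation of the solution and of the frame *)

Section Transform.
Variables (R : realType) (n m : nat) (eps c : R).
Local Notation C := R[i].
Local Notation o := (ord0 : 'I_n.+1).
Local Notation l := (lift (ord0 : 'I_n.+1)).
Local Notation toC := (map_mx (real_complex R)).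

Lemma smooth_cmx_real (W : set 'rV[R]_n) p q (A : 'rV[R]_n -> 'M[R]_(p, q)) :
  open W -> (forall k k', smooth_on W (fun y => A y k k')) ->
  smooth_cmx W (fun y => toC (A y)).
Proof.
move=> oW sA k k'; split.
  by move: (sA k k'); congr smooth_on; apply/funext => y; rewrite mxE.
move: (smooth_cst (n := n) (U := W) (0 : R) oW); congr smooth_on.
by apply/funext => y; rewrite mxE.
Qed.

Lemma smooth_real_cmx (W : set 'rV[R]_n) p q (A : 'rV[R]_n -> 'M[R]_(p, q)) :
  smooth_cmx W (fun y => toC (A y)) ->
  forall k k', smooth_on W (fun y => A y k k').
Proof.
move=> sA k k'; have [sR _] := sA k k'.
by move: sR; congr smooth_on; apply/funext => y; rewrite mxE.
Qed.

Lemma cmx_derive_real i x p q (A : 'rV[R]_n -> 'M[R]_(p, q)) A' :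
  cmx_derive i x (fun y => toC (A y)) (toC A') ->
  forall k k', pd i (fun y => A y k k' : R) x = A' k k'.
Proof.
move=> dA k k'.
have <- : (fun y => complex.Re (toC (A y) k k')) = (fun y => A y k k').
  by apply/funext => y; rewrite mxE.
by have [[_ e] _] := dA k k'; rewrite /pd e mxE.
Qed.

Variables (W : set 'rV[R]_n) (v : 'I_n -> 'rV[R]_n -> R).
Variables (h : 'I_n -> 'I_n -> 'rV[R]_n -> R) (P : 'M[R]_m).
Variables (phi : 'rV[R]_n -> 'cV[R]_m) (gam : 'I_n -> 'rV[R]_n -> 'cV[R]_m).
Variables (Omega : 'rV[R]_n -> 'M[R]_m) (g : 'rV[R]_n -> 'M[R]_n).
Hypothesis oW : open W.
Hypothesis v0 : forall i x, W x -> v i x != 0.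
Hypothesis gE : forall i j x, W x -> g x i j = if i == j then v i x ^+ 2 else 0.
Hypothesis hv : solves_hv_system c W v h.
Hypothesis hC : forall i j x, W x -> i != j -> h i j x = h j i x.
Hypothesis sP : spectrum_condition P.
Hypothesis lin : solves_linear_system c W v h P phi gam.
Hypothesis syl : forall x, W x -> sylvester_solution c g P phi x (Omega x)^T.
Hypothesis uO : forall x, W x -> Omega x \in unitmx.

Let Q := invmx P.
Let uP : P \in unitmx := spectrum_unit sP.
Let PQ : P *m Q = 1%:M := mulmxV uP.
Let QP : Q *m P = 1%:M := mulVmx uP.
Let Phi y : 'M[R]_(n.+1, m) := row_stack (phi y)^T (fun j => (gam j y)^T).
Let J := head_diag n c.
Let D y := (Phi y)^T *m J *m Phi y.
Let Z := invmx (P + Q).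
Let N y := Omega y *m Z.
Let M y := (P + Q) *m invmx (Omega y).
Let S y := Phi y *m M y *m (Phi y)^T.
Let A i y := frame_conn c (v^~ y) (fun a b => h a b y) i.

Lemma sqrP_add1 : P *m P + 1%:M = P *m (P + Q).
Proof. by rewrite mulmxDr PQ. Qed.

Lemma unit_PaddQ : P + Q \in unitmx.
Proof.
by have := spectrum_unit_sqrD1 sP; rewrite sqrP_add1 unitmx_mul => /andP[].
Qed.

Lemma comm_P_Z : P *m Z = Z *m P.
Proof.
have e : (P + Q) *m P = P *m (P + Q) by rewrite mulmxDl mulmxDr QP PQ.
have u := unit_PaddQ.
by rewrite -[P *m Z](mulKmx u) -/Z [(P + Q) *m _]mulmxA e -(mulmxA P) mulmxV// mulmx1.
Qed.

Lemma gram_sym y : (D y)^T = D y.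
Proof. by rewrite /D !trmx_mul trmxK tr_head_diag mulmxA. Qed.

(** The operator d phi (d phi)^t + c phi phi^t is the Gram matrix of the rows
    of Phi: the factors v_j cancel against the inverse metric. *)
Lemma gram_jacobian x : W x ->
  Defs.jacobian phi x *m jacobian_adj g phi x + c *: (phi x *m (phi x)^T) = D x.
Proof.
move=> Wx; have [_ dphi _ _] := lin.
rewrite /jacobian_adj (diag_metric_inv v0 gE Wx).
apply/matrixP => k q; rewrite mxDE mxZE [in RHS]mxE big_ord_recl addrC.
congr (_ + _).
  by rewrite mxE big_ord1 mul_head_diag eqxx [(Phi x)^T _ _]mxE !row_stack0 !mxE; ring.
rewrite mxE; apply: eq_bigr => j _.
rewrite mul_head_diag [(Phi x)^T _ _]mxE !row_stackS mul_diag_mx !mxE dphi// !mxE.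
have vj := v0 j Wx; rewrite /=; field.
by rewrite vj.
Qed.

(** The transposed equation for Omega, divided on the right by P + P^-1. *)
Lemma N_sylvester x : W x -> P^T *m N x + N x *m P = P^T *m D x *m P.
Proof.
move=> Wx; have := syl Wx; rewrite /sylvester_solution gram_jacobian//.
move: (D x) (gram_sym x) => Dx trDx /(congr1 trmx).
rewrite linearD /= !trmx_mul linearD /= !trmx_mul !trmxK trmx1 trDx.
rewrite sqrP_add1 addrC => /(congr1 (mulmx^~ Z)).
have eZ : P *m (P + Q) *m Z = P by rewrite -mulmxA mulmxV ?unit_PaddQ// mulmx1.
rewrite mulmxDl -(mulmxA _ P Z) comm_P_Z -!(mulmxA P^T) -(mulmxA Dx) eZ /N.
by rewrite !mulmxA.
Qed.

(** The Sylvester equation of N is invariant under transposition and has a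
    unique solution. *)
Lemma N_sym x : W x -> (N x)^T = N x.
Proof.
move=> Wx; apply: (sylvester_uniq sP); move: (N_sylvester Wx) (gram_sym x).
move: (N x) (D x) => Nx Dx e trDx; rewrite e.
have := congr1 trmx e; rewrite linearD /= !trmx_mul !trmxK trDx mulmxA => <-.
by rewrite addrC.
Qed.

Lemma mul_M_N x : W x -> M x *m N x = 1%:M.
Proof.
move=> Wx; rewrite /M /N mulmxA -(mulmxA (P + Q)) mulVmx ?uO// mulmx1.
by rewrite mulmxV// unit_PaddQ.
Qed.

Lemma mul_N_M x : W x -> N x *m M x = 1%:M.
Proof. by move=> /mul_M_N /mulmx1C. Qed.

Lemma M_sym x : W x -> (M x)^T = M x.
Proof.
move=> Wx; move: (mul_N_M Wx) (N_sym Wx); move: (N x) (M x) => Nx Mx e trNx.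
have e' := congr1 trmx e; rewrite trmx_mul trNx trmx1 in e'.
by rewrite -[LHS]mulmx1 -e mulmxA e' mul1mx.
Qed.

Lemma N_sylvester_Q x : W x -> N x *m Q + Q^T *m N x = D x.
Proof.
move=> Wx; have PtQt : Q^T *m P^T = 1%:M by rewrite -trmx_mul PQ trmx1.
have := congr1 (fun X => Q^T *m X *m Q) (N_sylvester Wx).
move: (N x) (D x) => Nx Dx.
rewrite mulmxDr mulmxDl !mulmxA PtQt !mul1mx -!(mulmxA _ P) PQ !mulmx1.
by [].
Qed.

Lemma smooth_Phi : smooth_cmx W (fun y => toC (Phi y)).
Proof.
have [[sphi sgam] _ _ _] := lin.
apply: smooth_cmx_real => // a k; case: (unliftP o a) => [j|] ->.
  have := (smooth_mxP (gam j) oW).1 (sgam j) k 0.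
  by congr smooth_on; apply/funext => y; rewrite /Phi row_stackS mxE.
have := (smooth_mxP phi oW).1 sphi k 0.
by congr smooth_on; apply/funext => y; rewrite /Phi row_stack0 mxE.
Qed.

Lemma toC_leg_proj (i : 'I_n) : toC (leg_proj R i) = leg_proj C i.
Proof.
by apply/matrixP => a b; rewrite !mxE; case: (_ && _); rewrite ?rmorph1 ?rmorph0.
Qed.

(** The linear system for phi and the gamma_j is the frame system with the
    imaginary unit replaced by -Q on the right. *)
Lemma derive_Phi i x : W x -> cmx_derive i x (fun y => toC (Phi y))
  (toC (A i x) *m toC (Phi x) - leg_proj C i *m toC (Phi x) *m toC Q).
Proof.
move=> Wx; have [[sphi sgam] dphi dgam dgami] := lin.
have := smooth_cmx_derive i smooth_Phi Wx; congr cmx_derive.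
have pd_phi k : pd i (fun y => complex.Re (toC (Phi y) o k)) x = pd i phi x k 0.
  rewrite pd_mxE; last first.
    by move=> a b; exact: (smooth_on_C1 ((smooth_mxP phi oW).1 sphi a b) Wx).2.
  by congr (pd i _ x); apply/funext => y; rewrite mxE /Phi row_stack0 mxE.
have pd_gam j k : pd i (fun y => complex.Re (toC (Phi y) (l j) k)) x = pd i (gam j) x k 0.
  rewrite pd_mxE; last first.
    by move=> a b; exact: (smooth_on_C1 ((smooth_mxP (gam j) oW).1 (sgam j) a b) Wx).2.
  by congr (pd i _ x); apply/funext => y; rewrite mxE /Phi row_stackS mxE.
have pd_im a k : pd i (fun y => complex.Im (toC (Phi y) a k)) x = 0.
  have -> : (fun y => complex.Im (toC (Phi y) a k)) = cst 0.
    by apply/funext => y; rewrite mxE.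
  exact: derive_cst.
rewrite -toC_leg_proj -!map_mxM -map_mxB; apply: row_stackP => [b|j b].
  rewrite [LHS]mxE pd_phi pd_im [RHS]mxE dphi//; congr Complex.
  by rewrite mxZE mxDE mxNE -mulmxA leg_proj_mul oppr0 addr0 frame_conn_mul0 row_stackS mxE.
rewrite [LHS]mxE pd_gam pd_im [RHS]mxE; congr Complex.
rewrite mxDE mxNE -mulmxA leg_proj_mul lift0_eq; have [->|ji] := eqVneq j i.
  rewrite frame_conn_mul_eq row_stack0 mxE.
  move/eqP: (dgami i x Wx); rewrite -!addrA addr_eq0 => /eqP ->.
  rewrite mxNE !mxDE mxZE -trmx_inv !mxE summxE.
  rewrite (eq_bigr (fun k => h k i x * Phi x (l k) b)); last first.
    by move=> k _; rewrite mxZE /Phi row_stackS mxE.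
  have -> : \sum_k (invmx P)^T b k * gam i x k 0
           = \sum_k Phi x (l i) k * Q k b.
    by apply: eq_bigr => k _; rewrite /Phi row_stackS !mxE mulrC.
  by ring.
by rewrite dgam 1?eq_sym// mxZE oppr0 addr0 frame_conn_mul_neq// /Phi row_stackS mxE.
Qed.

Lemma toC_head_diag (a : R) : toC (head_diag n a) = head_diag n (a%:C)%C.
Proof.
by apply/matrixP => i j; rewrite !mxE; case: (i == j); case: (i == ord0).
Qed.

Lemma toC_tr p q (X : 'M[R]_(p, q)) : toC X^T = (toC X)^T.
Proof. by rewrite map_trmx. Qed.

Lemma toC_frame_conn_skew i x : (toC (A i x))^T *m toC J = - (toC J *m toC (A i x)).
Proof. by rewrite -toC_tr -!map_mxM frame_conn_skew map_mxN. Qed.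

Lemma smooth_D : smooth_cmx W (fun y => toC (D y)).
Proof.
apply: (smooth_cmx_eq (A := fun y => (toC (Phi y))^T *m toC J *m toC (Phi y)) oW).
  by move=> y _; rewrite /D !map_mxM toC_tr.
apply: (smooth_cmxM oW _ smooth_Phi); apply: (smooth_cmxM oW).
  exact: smooth_cmx_tr smooth_Phi.
exact: smooth_cmx_cst.
Qed.

Lemma derive_D i x : W x -> cmx_derive i x (fun y => toC (D y))
  (- ((toC Q)^T *m ((toC (Phi x))^T *m leg_proj C i *m toC (Phi x))
      + (toC (Phi x))^T *m leg_proj C i *m toC (Phi x) *m toC Q)).
Proof.
move=> Wx; have dP := derive_Phi i Wx.
have := cmx_deriveM (cmx_deriveM (cmx_derive_tr dP) (cmx_derive_cst (toC J) i x)) dP.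
rewrite mulmx0 addr0.
rewrite (dressing_gram_derive _ _ (toC_frame_conn_skew i x) _ _ (tr_leg_proj C i)); last 2 first.
- by rewrite toC_head_diag head_diag_leg_proj.
- by rewrite toC_head_diag leg_proj_head_diag.
by congr cmx_derive; apply/funext => y; rewrite /D !map_mxM toC_tr.
Qed.

Lemma smooth_N : smooth_cmx W (fun y => toC (N y)).
Proof.
apply: smooth_cmx_real => //.
apply: (smooth_sylvester oW sP (D := fun y => P^T *m D y *m P)); last first.
  exact: N_sylvester.
apply: smooth_real_cmx.
apply: (smooth_cmx_eq (A := fun y => toC P^T *m toC (D y) *m toC P) oW).
  by move=> y _; rewrite !map_mxM.
apply: (smooth_cmxM oW); last exact: smooth_cmx_cst.
by apply: (smooth_cmxM oW); [exact: smooth_cmx_cst|exact: smooth_D].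
Qed.

(** The derivative of the Sylvester equation has a right-hand side for which a
    solution is visible; uniqueness identifies it with the derivative of N. *)
Lemma derive_N i x : W x -> cmx_derive i x (fun y => toC (N y))
  (- ((toC (Phi x))^T *m leg_proj C i *m toC (Phi x))).
Proof.
move=> Wx; have := smooth_cmx_derive i smooth_N Wx; congr cmx_derive.
set N' := cmx_pd _ _ _; set X := _ *m _ *m _.
have dN : cmx_derive i x (fun y => toC (N y)) N' := smooth_cmx_derive i smooth_N Wx.
have dC (B : 'M[C]_m) := cmx_derive_cst B i x.
have e : toC P^T *m N' + N' *m toC P =
         toC P^T *m (- ((toC Q)^T *m X + X *m toC Q)) *m toC P.
  have := cmx_deriveD (cmx_deriveM (dC (toC P^T)) dN) (cmx_deriveM dN (dC (toC P))).
  have := cmx_deriveM (cmx_deriveM (dC (toC P^T)) (derive_D i Wx)) (dC (toC P)).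
  rewrite !mul0mx !mulmx0 !add0r !addr0 => d1 d2.
  apply: (cmx_derive_uniq d2).
  apply: (cmx_derive_near oW Wx _ d1) => y Wy.
  by rewrite -!map_mxM -map_mxD N_sylvester.
apply: (sylvester_uniq_cplx sP) => /=; rewrite -toC_tr e.
have PtQt : toC P^T *m (toC Q)^T = 1%:M.
  by rewrite -toC_tr -map_mxM -trmx_mul QP trmx1 map_mx1.
have QPc : toC Q *m toC P = 1%:M by rewrite -map_mxM QP map_mx1.
rewrite mulmxN mulNmx mulmxDr mulmxDl mulmxA PtQt mul1mx mulmxA.
by rewrite -(mulmxA _ (toC Q)) QPc mulmx1 mulmxN mulNmx opprD addrC.
Qed.

Lemma unitN x : W x -> N x \in unitmx.
Proof. by move=> /mul_M_N /mulmx1_unit[]. Qed.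

Lemma M_inv x : W x -> M x = invmx (N x).
Proof.
move=> Wx; rewrite -[LHS]mulmx1 -(mulmxV (unitN Wx)) mulmxA mul_M_N// mul1mx.
by [].
Qed.

Lemma smooth_M : smooth_cmx W (fun y => toC (M y)).
Proof.
apply: smooth_cmx_real => // k k'.
have := smooth_invmx oW (smooth_real_cmx smooth_N) unitN k k'.
by apply: (smooth_on_eq oW) => y Wy; rewrite M_inv.
Qed.

Lemma derive_M i x : W x -> cmx_derive i x (fun y => toC (M y))
  (toC (M x) *m (toC (Phi x))^T *m leg_proj C i *m toC (Phi x) *m toC (M x)).
Proof.
move=> Wx; have := smooth_cmx_derive i smooth_M Wx; congr cmx_derive.
set M' := cmx_pd _ _ _.
have dM : cmx_derive i x (fun y => toC (M y)) M' := smooth_cmx_derive i smooth_M Wx.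
have e : M' *m toC (N x) + toC (M x) *m (- ((toC (Phi x))^T *m leg_proj C i *m toC (Phi x))) = 0.
  apply: (cmx_derive_uniq (cmx_deriveM dM (derive_N i Wx))).
  apply: (cmx_derive_near oW Wx _ (cmx_derive_cst 1%:M i x)) => y Wy.
  by rewrite -map_mxM mul_M_N// map_mx1.
have NMc : toC (N x) *m toC (M x) = 1%:M by rewrite -map_mxM mul_N_M// map_mx1.
rewrite -[LHS]mulmx1 -NMc mulmxA.
move/eqP: e; rewrite mulmxN subr_eq0 => /eqP ->.
by rewrite !mulmxA.
Qed.

Lemma smooth_S : smooth_cmx W (fun y => toC (S y)).
Proof.
apply: (smooth_cmx_eq (A := fun y => toC (Phi y) *m toC (M y) *m (toC (Phi y))^T) oW).
  by move=> y _; rewrite /S !map_mxM toC_tr.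
apply: (smooth_cmxM oW); last exact: smooth_cmx_tr smooth_Phi.
exact: (smooth_cmxM oW smooth_Phi smooth_M).
Qed.

Lemma S_sym x : W x -> (S x)^T = S x.
Proof.
move=> Wx; rewrite /S; move: (M x) (M_sym Wx) => Mx trMx.
by rewrite !trmx_mul trmxK trMx mulmxA.
Qed.

Lemma S_symE x a b : W x -> S x a b = S x b a.
Proof. by move=> /S_sym/matrixP/(_ b a) <-; rewrite [RHS]mxE. Qed.

Let X x := Phi x *m Q *m M x *m (Phi x)^T.

(** The partial derivatives of S entry by entry: the entries of A S have a
    closed form away from the i-th leg, and the terms with X only occur there.
    *)
Lemma pd_S i x : W x -> forall a b, pd i (fun y => S y a b : R) x =
  (A i x *m S x) a b + (A i x *m S x) b a
  - (if a == l i then X x (l i) b else 0) - (if b == l i then X x (l i) a else 0)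
  + S x a (l i) * S x (l i) b.
Proof.
move=> Wx a b.
pose S' := A i x *m S x + S x *m (A i x)^T - leg_proj R i *m X x - (X x)^T *m leg_proj R i
  + S x *m leg_proj R i *m S x.
have -> : pd i (fun y => S y a b : R) x = S' a b.
  apply: cmx_derive_real; have dP := derive_Phi i Wx.
  have := cmx_deriveM (cmx_deriveM dP (derive_M i Wx)) (cmx_derive_tr dP).
  have trMc : (toC (M x))^T = toC (M x) by rewrite -toC_tr M_sym.
  rewrite (dressing_S_derive _ _ _ (tr_leg_proj C i) trMc).
  have -> : (toC (A i x) *m (toC (Phi x) *m toC (M x) *m (toC (Phi x))^T) +
     toC (Phi x) *m toC (M x) *m (toC (Phi x))^T *m (toC (A i x))^T -
     leg_proj C i *m (toC (Phi x) *m toC Q *m toC (M x) *m (toC (Phi x))^T) -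
     (toC (Phi x) *m toC Q *m toC (M x) *m (toC (Phi x))^T)^T *m leg_proj C i +
     toC (Phi x) *m toC (M x) *m (toC (Phi x))^T *m leg_proj C i *m
     (toC (Phi x) *m toC (M x) *m (toC (Phi x))^T)) = toC S'.
    by rewrite /S' /S /X map_mxD !map_mxB map_mxD !map_mxM -!toC_leg_proj !toC_tr !map_mxM !toC_tr.
  by congr cmx_derive; apply/funext => y; rewrite /S !map_mxM toC_tr.
rewrite /S' 4!mxDE 2!mxNE leg_proj_mul mul_leg_proj [(X x)^T _ _]mxE.
have -> : (S x *m (A i x)^T) a b = (A i x *m S x) b a.
  by rewrite -{1}(S_sym Wx) -trmx_mul mxE.
congr (_ + _); rewrite mxE (bigD1 (l i))//= big1 ?addr0.
  by rewrite mul_leg_proj eqxx.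
by move=> k ki; rewrite mul_leg_proj (negPf ki) mul0r.
Qed.

Let vt := v_tilde v P phi gam Omega.
Let ht := h_tilde h P gam Omega.

Lemma row_Phi0 x : (row o (Phi x))^T = phi x.
Proof. by apply/matrixP => a b; rewrite 2!mxE row_stack0 mxE [b]ord1. Qed.

Lemma row_PhiS j x : (row (l j) (Phi x))^T = gam j x.
Proof. by apply/matrixP => a b; rewrite 2!mxE row_stackS mxE [b]ord1. Qed.

Lemma S_entry x a b :
  S x a b = dotv (row a (Phi x))^T (M x *m (row b (Phi x))^T).
Proof.
rewrite /dotv trmxK mulmxA -row_mul mxE [RHS]mxE; apply: eq_bigr => k _.
by rewrite !mxE.
Qed.

Lemma v_tildeE i x : W x -> vt i x = v i x + S x o (l i).
Proof.
move=> Wx; rewrite /vt /v_tilde; congr (_ + _).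
have -> : S x o (l i) = S x (l i) o by exact: S_symE.
by rewrite S_entry row_Phi0 row_PhiS.
Qed.

Lemma h_tildeE i j x : W x -> ht i j x = h i j x + S x (l i) (l j).
Proof.
move=> Wx; rewrite /ht /h_tilde; congr (_ + _).
have -> : S x (l i) (l j) = S x (l j) (l i) by exact: S_symE.
by rewrite S_entry !row_PhiS.
Qed.

Let sS := smooth_real_cmx smooth_S.

(** The corrections are entries of the symmetric matrix S. *)
Lemma h_tilde_sym i j x : W x -> i != j -> ht i j x = ht j i x.
Proof.
move=> Wx ij; rewrite !h_tildeE// hC//; congr (_ + _).
exact: S_symE.
Qed.

Lemma pd_v_tilde i j x : W x -> i != j -> pd j (vt i) x = ht j i x * vt j x.
Proof.
move=> Wx ij; have [[sv _] pdv _ _] := hv.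
have -> : pd j (vt i) x = pd j (v i) x + pd j (fun y => S y o (l i) : R) x.
  rewrite (pd_eq (g := fun y => v i y + S y o (l i)) j oW Wx); last first.
    by move=> y Wy; exact: v_tildeE.
  by apply: deriveD; [exact: (smooth_on_C1 (sv i) Wx).2|
    exact: (smooth_on_C1 (sS o (l i)) Wx).2].
rewrite pdv// pd_S// lift0_eq neq_lift0 (negPf ij) !subr0.
rewrite frame_conn_mul0 frame_conn_mul_neq// h_tildeE// v_tildeE// (hC Wx ij).
have -> : S x (l j) o = S x o (l j) by exact: S_symE.
by ring.
Qed.

Lemma pd_h_tilde i j k x : W x -> i != j -> pd k (ht i j) x =
  pd k (h i j) x + pd k (fun y => S y (l i) (l j) : R) x.
Proof.
move=> Wx ij; have [[_ sh] _ _ _] := hv.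
rewrite (pd_eq (g := fun y => h i j y + S y (l i) (l j)) k oW Wx); last first.
  by move=> y Wy; exact: h_tildeE.
by apply: deriveD; [exact: (smooth_on_C1 (sh i j ij) Wx).2|
  exact: (smooth_on_C1 (sS (l i) (l j)) Wx).2].
Qed.

(** Off the exceptional indices the equations for v-tilde and h-tilde are
    products of the binomials h + S and v + S. For the sum over all
    derivatives, symmetry of h removes the connection and dressing_S_quad
    replaces the terms with Q. *)
Lemma tilde_solves_hv : solves_hv_system c W vt ht.
Proof.
have [[sv sh] pdv sumh pdh] := hv; split.
- split=> [i|i j ij].
    apply: (smooth_on_eq (f := fun y => v i y + S y o (l i)) oW).
      by move=> y Wy; rewrite v_tildeE.
    exact: (smoothD oW (sv i) (sS _ _)).
  apply: (smooth_on_eq (f := fun y => h i j y + S y (l i) (l j)) oW).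
    by move=> y Wy; rewrite h_tildeE.
  exact: (smoothD oW (sh i j ij) (sS _ _)).
- by move=> i j x Wx ij; exact: pd_v_tilde.
- move=> i j x Wx ij.
  have Sy a b : S x a b = S x b a := S_symE a b Wx.
  under eq_bigr do rewrite pd_h_tilde//.
  rewrite big_split /=; move: (sumh i j x Wx ij).
  set s1 := \sum_(_ < _) _ => e.
  have hCx k q : k != q -> h k q x = h q k x by move=> kq; exact: hC.
  have -> : \sum_k pd k (fun y => S y (l i) (l j) : R) x =
     - (c * v i x * S x o (l j)) - c * v j x * S x o (l i)
     - X x (l i) (l j) - X x (l j) (l i) + \sum_k S x (l i) (l k) * S x (l k) (l j).
    under eq_bigr do rewrite pd_S// !lift0_eq.
    rewrite big_split /= 2!sumrB big_split /= !sum_frame_conn_mul; last 2 first.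
    - by move=> k kj; exact: hCx.
    - by move=> k kj; exact: hCx.
    rewrite -!big_mkcond /= (big_pred1 i); last by move=> k; rewrite /= eq_sym.
    by rewrite (big_pred1 j)// => k; rewrite /= eq_sym.
  (* The terms with Q become the quadratic terms of the transformed equation. *)
have quad : X x (l i) (l j) + X x (l j) (l i) =
      c * S x (l i) o * S x o (l j) + \sum_k S x (l i) (l k) * S x (l k) (l j).
    have := dressing_S_quad (J := J) (mul_M_N Wx) (mul_N_M Wx) (N_sylvester_Q Wx) (M_sym Wx).
    move=> /matrixP/(_ (l i) (l j)); rewrite mxE [(_^T) _ _]mxE => ->.
    rewrite mxE big_ord_recl mul_head_diag eqxx; congr (_ + _); first by ring.
    by apply: eq_bigr => k _; rewrite mul_head_diag mulr1.
  rewrite !v_tildeE//.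
  move: quad; set s3 := \sum_(_ < _) _ => quad.
  rewrite (Sy (l i) o) in quad.
  rewrite (_ : s1 = - (c * v i x * v j x)); last first.
    by apply/eqP; rewrite -addr_eq0 e.
  have -> : X x (l i) (l j) = c * S x o (l i) * S x o (l j) + s3 - X x (l j) (l i).
    by rewrite -quad addrK.
  by ring.
- move=> i j k x Wx ki ij jk; rewrite pd_h_tilde// pdh// pd_S//.
  rewrite !lift0_eq [i == k]eq_sym (negPf ki) (negPf jk) !subr0.
  rewrite !frame_conn_mul_neq// 1?eq_sym// !h_tildeE//.
  have -> : S x (l k) (l i) = S x (l i) (l k) by exact: S_symE.
  have -> : S x (l k) (l j) = S x (l j) (l k) by exact: S_symE.
  by ring.
Qed.

Variable Psi : 'rV[R]_n -> 'M[C]_n.+1.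
Hypothesis sPsi : smooth_cmx W Psi.
Hypothesis frame : moving_frame eps c W v h Psi.
Hypothesis c0 : c != 0.

Let K := toC Z + 'i%C *: toC (P *m Z).
Let Kt := K^T.
Let L x := toC (M x) *m Kt.
Let Psit x := Psi x - toC (Phi x) *m L x *m ((toC (Phi x))^T *m toC J *m Psi x).

(** K = (1 + i P)(P + Q)^-1 is the inverse of Q - i, since (1 + i P)(Q - i) =
    P + Q. *)
Lemma K_resolvent : K *m (toC Q - 'i%C%:M) = 1%:M.
Proof.
have -> : toC Q - 'i%C%:M = toC Q - 'i%C *: 1%:M by rewrite scalemx1.
rewrite /K mulmxBr !mulmxDl !mulmxZ !mulZmx !mulmx1 -!map_mxM scalerA.
have -> : P *m Z *m Q = Z by rewrite comm_P_Z -mulmxA PQ mulmx1.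
have e : toC (Z *m Q) + toC (P *m Z) = 1%:M.
  by rewrite -map_mxD comm_P_Z -mulmxDr addrC mulVmx ?unit_PaddQ// map_mx1.
rewrite -e -expr2 sqr_i scaleN1r.
by rewrite opprD opprK addrA addrK.
Qed.

Lemma Kt_right_inverse : ((toC Q)^T - 'i%C%:M) *m Kt = 1%:M.
Proof.
have := congr1 trmx K_resolvent; rewrite trmx_mul trmx1 -/Kt linearB /= tr_scalar_mx.
exact.
Qed.

Lemma Kt_left_inverse : Kt *m ((toC Q)^T - 'i%C%:M) = 1%:M.
Proof. exact: (mulmx1C Kt_right_inverse). Qed.

Lemma smooth_Psit : smooth_cmx W Psit.
Proof.
have sL : smooth_cmx W L by apply: (smooth_cmxM oW smooth_M); exact: smooth_cmx_cst.
apply: (smooth_cmxD oW sPsi); apply: (smooth_cmxN oW).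
apply: (smooth_cmxM oW (smooth_cmxM oW smooth_Phi sL)).
apply: (smooth_cmxM oW _ sPsi); apply: (smooth_cmxM oW).
  exact: smooth_cmx_tr smooth_Phi.
exact: smooth_cmx_cst.
Qed.

(** The dressed frame: the algebraic identities of the dressing, applied to
    the actual derivatives, with the corrected connection recognised by
    frame_conn_dress. *)
Lemma tilde_moving_frame : moving_frame eps c W vt ht Psit.
Proof.
have [dPsi uPsi] := frame.
have JE i : toC J *m leg_proj C i = leg_proj C i by rewrite toC_head_diag head_diag_leg_proj.
have EJ i : leg_proj C i *m toC J = leg_proj C i by rewrite toC_head_diag leg_proj_head_diag.
have MNc x : W x -> toC (M x) *m toC (N x) = 1%:M.
  by move=> Wx; rewrite -map_mxM mul_M_N// map_mx1.
have NMc x : W x -> toC (N x) *m toC (M x) = 1%:M.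
  by move=> Wx; rewrite -map_mxM mul_N_M// map_mx1.
have NQc x : W x -> toC (N x) *m toC Q + (toC Q)^T *m toC (N x)
    = (toC (Phi x))^T *m toC J *m toC (Phi x).
  by move=> Wx; rewrite -!toC_tr -!map_mxM -map_mxD N_sylvester_Q.
split=> [i x Wx|x Wx].
  have dP := derive_Phi i Wx; have dF := dPsi i x Wx.
  have dL := cmx_deriveM (derive_M i Wx) (cmx_derive_cst Kt i x).
  have dG := cmx_deriveM (cmx_deriveM (cmx_derive_tr dP) (cmx_derive_cst (toC J) i x)) dF.
  have := cmx_deriveB dF (cmx_deriveM (cmx_deriveM dP dL) dG).
  rewrite !mulmx0 !addr0 -(mulmxA _ (toC (M x)) Kt).
  rewrite (dressing_potential_derive _ _ _ _ (toC_frame_conn_skew i x) (JE i) (EJ i) (tr_leg_proj C i)).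
  rewrite (dressing_derive _ _ _ (MNc x Wx) (NMc x Wx) (NQc x Wx) (erefl _) Kt_right_inverse Kt_left_inverse).
  congr cmx_derive; congr (_ *m _ + _).
  rewrite /cframe_conn -!toC_leg_proj -toC_tr -!map_mxM -map_mxD -map_mxB; congr map_mx.
  rewrite -/(S x) (frame_conn_dress _ _ _ _ (S_sym Wx)) /A.
  by congr frame_conn; apply/funext => j; rewrite ?v_tildeE//; apply/funext => k; rewrite h_tildeE.
have JJi : toC J *m head_diag n (c^-1%:C)%C = 1%:M.
  apply/matrixP => a b; rewrite toC_head_diag head_diag_mul !mxE.
  case: (a == b); last by rewrite mulr0.
  by case: (a == o); rewrite ?mulr1// -rmorphM mulfV// rmorph1.
have KLs : (toC Q + 'i%C%:M) *m conjmx (L x) = toC (M x).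
  rewrite /L conjmxM conjmx_real M_sym// mulmxA.
  have -> : (toC Q + 'i%C%:M) *m conjmx Kt = 1%:M; last by rewrite mul1mx.
  have := congr1 (@conjmx R _ _) Kt_left_inverse; rewrite conjmxM conjmxB -toC_tr conjmx_real trmxK.
  have -> : conjmx ('i%C%:M : 'M[C]_m) = - 'i%C%:M.
    apply/matrixP => a b; rewrite !mxE eq_sym; case: eqP => _; rewrite ?mulr0n ?mulr1n.
      by apply: complex_eq; rewrite /= ?oppr0.
    by apply: complex_eq; rewrite /= ?oppr0.
  rewrite opprK => ->; rewrite /conjmx map_mx1 trmx1//.
have := dressing_gram (Phi := toC (Phi x)) (J := toC J) (MNc x Wx) (NMc x Wx) (NQc x Wx)
  (erefl (L x)) Kt_left_inverse JJi (mulmx1C JJi) (uPsi x Wx) KLs.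
move=> <-; congr (_ *m _); rewrite /Psit conjmxB; congr (_ - _).
rewrite !conjmxM -toC_tr !conjmx_real trmxK tr_head_diag !mulmxA.
by [].
Qed.

Variable F : 'rV[R]_n -> 'rV[C]_n.+1.
Hypothesis rowF : forall x, W x -> row o (Psi x) = F x.
Hypothesis rowf : forall j x, W x ->
  row (l j) (Psi x) = (((v j x)^-1)%:C)%C *: cpd j F x.

(** Row 0 of the dressed frame is the map of the theorem: the transpose of L
    is (1 + i P) Omega^-1, whose real and imaginary parts give the
    coefficients of F and of the legs. *)
Lemma row0_Psit x : W x -> row o (Psit x) = F_tilde c F v P phi gam Omega x.
Proof.
move=> Wx; rewrite /F_tilde.
have Lt a : (toC (Phi x) *m L x *m (toC (Phi x))^T) o a
   = Complex (dotv (invmx (Omega x) *m phi x) (row a (Phi x))^T)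
             (dotv (P *m invmx (Omega x) *m phi x) (row a (Phi x))^T).
  have -> : L x = (toC (invmx (Omega x)) + 'i%C *: toC (P *m invmx (Omega x)))^T.
    rewrite /L /Kt -(M_sym Wx) toC_tr -trmx_mul; congr trmx.
    rewrite /K mulmxDl mulZmx -!map_mxM /M -mulmxA.
    by rewrite !(mulmxA Z) mulVmx ?unit_PaddQ// mul1mx.
  rewrite linearD linearZ /= mulmxDr mulmxDl mulmxZ mulZmx -!toC_tr -!map_mxM.
  rewrite mxDE mxZE.
  have E (B : 'M[R]_m) : (Phi x *m B^T *m (Phi x)^T) o a
      = dotv (B *m phi x) (row a (Phi x))^T.
    rewrite /dotv trmx_mul -(row_Phi0 x) trmxK -row_mul mxE [RHS]mxE.
    by apply: eq_bigr => k _; rewrite !mxE.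
  rewrite [(toC _) o a]mxE [Y in _ + _ * Y]mxE !E.
  by apply: complex_eq; rewrite /= ?mul0r ?mul1r ?mulr0 ?subr0 ?addr0 ?add0r.
rewrite /Psit linearB /= rowF// -addrA; congr (_ + _).
rewrite -opprD; congr (- _).
rewrite -(mulmxA _ _ (Psi x)) (mulmxA _ (toC (Phi x))^T) toC_head_diag.
apply/matrixP => a b; rewrite [LHS]mxE [LHS]mxE big_ord_recl addrC.
rewrite mxDE; congr (_ + _).
  rewrite summxE; apply: eq_bigr => j _; rewrite Lt head_diag_mul mul1r row_PhiS.
  by rewrite mxZE -(rowf j Wx) [row _ _ _ _]mxE.
rewrite Lt head_diag_mul eqxx row_Phi0 mxZE mxZE -(rowF Wx).
by rewrite [row _ _ _ _]mxE.
Qed.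

End Transform.

(** * The transformed immersion *)

Section Locality.
Variables (R : realType) (n : nat) (eps c : R).
Local Notation C := R[i].
Implicit Types (W : set 'rV[R]_n) (F G : 'rV[R]_n -> 'rV[C]_n.+1).

Lemma cpd_eq W F G i x : open W -> W x -> (forall y, W y -> F y = G y) ->
  cpd i F x = cpd i G x.
Proof.
move=> oW Wx e; rewrite /cpd.
have -> : pd i (fun y => re_mx (F y)) x = pd i (fun y => re_mx (G y)) x.
  by apply: (pd_eq i oW Wx) => y Wy; rewrite e.
have -> // : pd i (fun y => im_mx (F y)) x = pd i (fun y => im_mx (G y)) x.
by apply: (pd_eq i oW Wx) => y Wy; rewrite e.
Qed.

Lemma principal_structure_eq W g F G : open W ->
  (forall y, W y -> F y = G y) ->
  principal_structure eps c W g F -> principal_structure eps c W g G.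
Proof.
move=> oW e psF x Wx; have [a b d f] := psF x Wx.
have ce q y : W y -> cpd q F y = cpd q G y by move=> Wy; exact: (cpd_eq q oW Wy e).
split.
- by rewrite -e.
- by move=> q; rewrite -e// -ce//.
- by move=> k q; rewrite -!ce.
move=> i j; apply: etrans (esym (cpd_eq i oW Wx (ce j))) _.
apply: (etrans (f i j)).
have cx : (fun q => cpd q F x) = (fun q => cpd q G x).
  by apply/funext => q; exact: ce.
exact: (congr2 (fun (t : 'I_n -> 'rV[C]_n.+1) z =>
  \sum_k ((christoffel g i j k x)%:C)%C *: t k - ((c * g x i j)%:C)%C *: z
  + (if i == j then Jmul (t i) else 0)) cx (e x Wx)).
Qed.

Lemma csmooth_eq W F G : open W -> (forall y, W y -> F y = G y) ->
  csmooth_on W F -> csmooth_on W G.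
Proof.
move=> oW e [sR sI]; split.
  by move: sR; apply: (smooth_on_eq oW) => y Wy; rewrite e.
by move: sI; apply: (smooth_on_eq oW) => y Wy; rewrite e.
Qed.

Lemma smooth_cmx_frame W (v : 'I_n -> 'rV[R]_n -> R) F : open W ->
  (forall i, smooth_on W (v i : 'rV[R]_n -> R)) ->
  (forall i x, W x -> v i x != 0) -> csmooth_on W F ->
  smooth_cmx W (fun y => row_stack (F y) (fun j => (((v j y)^-1)%:C)%C *: cpd j F y)).
Proof.
move=> oW sv v0 sF a b; have sFc := (csmooth_cmx F oW).1 sF.
case: (unliftP ord0 a) => [j|] ->; last first.
  have [sR sI] := sFc 0 b.
  by split; [move: sR|move: sI]; congr smooth_on; apply/funext => y; rewrite row_stack0.
have [sR sI] := (csmooth_cmx _ oW).1 (csmooth_cpd j oW sF) 0 b.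
have svi := smoothV oW (sv j) (v0 j); split.
  move: (smoothM oW svi sR); congr smooth_on; apply/funext => y.
  by rewrite row_stackS mxZE ReM /= mul0r mulr0 addr0.
move: (smoothM oW svi sI); congr smooth_on; apply/funext => y.
by rewrite row_stackS mxZE ImM /= mul0r addr0.
Qed.

End Locality.

Theorem corollary65 (R : realType) (n m : nat) (eps c : R)
  (U : set 'rV[R]_n) (g : 'rV[R]_n -> 'M[R]_n)
  (F : 'rV[R]_n -> 'rV[R[i]]_n.+1)
  (v : 'I_n -> 'rV[R]_n -> R) (h : 'I_n -> 'I_n -> 'rV[R]_n -> R)
  (P : 'M[R]_m) (W : set 'rV[R]_n)
  (phi : 'rV[R]_n -> 'cV[R]_m) (gam : 'I_n -> 'rV[R]_n -> 'cV[R]_m)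
  (Omega : 'rV[R]_n -> 'M[R]_m) :
  (eps = 1 \/ eps = -1) ->
  0 < eps * c ->
  open U ->
  riemannian_metric U g ->
  constant_curvature U g c ->
  isometric_immersion eps c U g F ->
  horizontal eps c U F ->
  (forall x, U x -> relative_nullity eps c g F x = 0%N) ->
  (forall i x, U x -> 0 < v i x) ->
  associated_solution eps c U g F v h ->
  spectrum_condition P ->
  open W ->
  W `<=` U ->
  solves_linear_system c W v h P phi gam ->
  (forall x, W x -> sylvester_solution c g P phi x (Omega x)^T) ->
  (forall x, W x -> Omega x \in unitmx) ->
  (forall i x, W x -> v_tilde v P phi gam Omega i x != 0) ->
  let Ft := F_tilde c F v P phi gam Omega in
  let gt := induced_metric eps Ft in
  [/\ riemannian_metric W gt,
      isometric_immersion eps c W gt Ft,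
      horizontal eps c W Ft,
      constant_curvature W gt c &
      associated_solution eps c W gt Ft
        (v_tilde v P phi gam Omega) (h_tilde h P gam Omega)].
Proof.
move=> _ epsc oU _ _ isoF horF _ _ assF sP oW WU lin syl uO vt0 Ft gt.
have c0 : c != 0 by apply: contraTneq epsc => ->; rewrite mulr0 ltxx.
have psU := associated_structure oU epsc isoF horF assF.
have ps : principal_structure eps c W g F by move=> x /WU; exact: psU.
have sF : csmooth_on W F.
  case: isoF => [[sR sI] _ _ _].
  by split; [exact: (smooth_on_sub WU sR)|exact: (smooth_on_sub WU sI)].
have [vU gU _ hU [[svU shU] pdvU sumU pdhU]] := assF.
have v0 i x : W x -> v i x != 0 by move=> /WU; exact: vU.
have gE i j x : W x -> g x i j = if i == j then v i x ^+ 2 else 0.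
  by move=> /WU; exact: gU.
have hC i j x : W x -> i != j -> h i j x = h j i x.
  by move=> /WU Ux ij; have [] := hU i j x Ux ij.
have hv : solves_hv_system c W v h.
  split.
  - split=> [i|i j ij]; first exact: (smooth_on_sub WU (svU i)).
    exact: (smooth_on_sub WU (shU i j ij)).
  - by move=> i j x /WU; exact: pdvU.
  - by move=> i j x /WU; exact: sumU.
  - by move=> i j k x /WU; exact: pdhU.
have [[sv sh] pdv _ _] := hv.
pose Psi y := row_stack (F y) (fun j => (((v j y)^-1)%:C)%C *: cpd j F y).
have sPsi : smooth_cmx W Psi := smooth_cmx_frame oW sv v0 sF.
have frame : moving_frame eps c W v h Psi := structure_frame oW sv v0 gE pdv sF ps.
have rowF x : W x -> row ord0 (Psi x) = F x.
  by move=> _; apply/matrixP => a b; rewrite ord1 mxE row_stack0.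
have rowf j x : W x -> row (lift ord0 j) (Psi x) = (((v j x)^-1)%:C)%C *: cpd j F x.
  by move=> _; apply/matrixP => a b; rewrite ord1 mxE row_stackS.
have hvt := tilde_solves_hv oW v0 gE hv hC sP lin syl uO.
have ft := tilde_moving_frame oW v0 gE sP lin syl uO frame c0.
have sPt := smooth_Psit oW v0 gE sP lin syl uO sPsi.
have rowt x Wx := row0_Psit v0 gE sP lin syl uO rowF rowf (x := x) Wx.
set Psit := fun x => _ in ft sPt rowt.
have [[svt sht] pdvt _ _] := hvt.
(* The structure equations are needed first for the explicit diagonal metric,
   which identifies the induced metric, and then for the induced metric
   itself. *)
have psd (g' : 'rV[R]_n -> 'M[R]_n) :
    (forall i j x, W x -> g' x i j =
       if i == j then v_tilde v P phi gam Omega i x ^+ 2 else 0) ->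
    principal_structure eps c W g' Ft.
  move=> g'E; apply: (principal_structure_eq oW rowt).
  exact: (frame_structure oW svt vt0 g'E pdvt sPt ft).
have gtE i j x : W x -> gt x i j =
    if i == j then v_tilde v P phi gam Omega i x ^+ 2 else 0.
  move=> Wx; rewrite mxE.
  pose g' y := \matrix_(i, j)
    (if i == j then v_tilde v P phi gam Omega i y ^+ 2 else 0).
  have [|_ _ gff _] := psd g' _ x Wx; first by move=> *; rewrite mxE.
  by have [-> _] := gff i j; rewrite mxE.
have sFt : csmooth_on W Ft.
  apply: (csmooth_eq oW rowt); apply/(csmooth_cmx _ oW) => a b.
  have [sR sI] := sPt ord0 b.
  by split; [move: sR|move: sI]; congr smooth_on; apply/funext => y;
    rewrite [in RHS]mxE.
apply: (principal_conclusions oW vt0 gtE hvt _ sFt (psd gt gtE)).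
by move=> i j x; exact: (h_tilde_sym v0 gE hC sP lin syl uO).
Qed.
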